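(* Let $H$ be a Hopf algebra with invertible antipode $S$ over a field $k$ of characteristic $0$ and let $i\in\mathbb{Z}$. For a $YD_{i-1}$-module $M$, equip $\widehat{M}=\mathrm{Hom}(H,M)^H$ with the left $H$-action $$h\cdot f=h^2f(S(h^3)-S^{-2i}(h^1))$$ and the $H$-contraaction $(\alpha\theta)(h)=\theta_{h^1}(h^2)$. For a $YD_{i+1}$-contramodule $N$, equip $N'=H\odot_HN$ with the left $H$-action $$h\cdot(x\otimes n)=h^3xS^{1-2i}(h^1)\otimes h^2n$$ and the $H$-coaction $x\otimes n\mapsto(x^1\otimes n)\otimes x^2$. This defines an adjoint pair of functors $((-)'_H,\widehat{(-)}_H)$ (with $(-)'_H$ left adjoint): $$\widehat{(-)}_H:YD_{i-1}\text{-mod}\rightleftarrows YD_{i+1}\text{-ctrmd}:(-)'_H.$$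
   Context: Sweedler notation: $\Delta(h)=h^1\otimes h^2$, $(\Delta\otimes1)\Delta(h)=h^1\otimes h^2\otimes h^3$ (superscripts on elements are Sweedler indices); a right coaction is $m\mapsto m_0\otimes m_1$. $\mathrm{Hom}$ denotes $k$-linear maps, $\mathrm{Hom}(-,-)^H$ right $H$-comodule maps; $f(a-b)$ means $x\mapsto f(axb)$. A right $H$-contramodule is a vector space $N$ with linear $\alpha:\mathrm{Hom}(H,N)\to N$ such that $\alpha(x\mapsto\alpha(h\mapsto f(x\otimes h)))=\alpha(h\mapsto f(h^1\otimes h^2))$ for $f\in\mathrm{Hom}(H\otimes H,N)$ and $\alpha(h\mapsto\epsilon(h)n)=n$. In $(\alpha\theta)(h)=\theta_{h^1}(h^2)$, $\theta\in\mathrm{Hom}(H,\widehat{M})$ is written $h\mapsto\theta_h$. For $j\in\mathbb{Z}$, a $YD_j$-module is a left $H$-module and right $H$-comodule $M$ with $(hm)_0\otimes(hm)_1=h^2m_0\otimes h^3m_1S^{-1-2j}(h^1)$. A $YD_j$-contramodule is a left $H$-module and right $H$-contramodule $N$ such that $h\alpha(f)=\alpha(h^2f(S(h^3)-S^{2-2j}(h^1)))$ for all $h\in H$, $f\in\mathrm{Hom}(H,N)$. Morphisms preserve both structures; the categories are $YD_j\text{-mod}$ and $YD_j\text{-ctrmd}$. $N'=H\odot_HN$ is the cokernel of the difference of the two maps $H\otimes\mathrm{Hom}(H,N)\to H\otimes N$, $h\otimes f\mapsto h\otimes\alpha(f)$ and $h\otimes f\mapsto h^2\otimes f(h^1)$.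 *)

(* Defs.v *)
From HB Require Import structures.
From mathcomp Require Import all_boot all_order all_algebra.
From mathcomp Require Import boolp classical_sets functions.

Set Implicit Arguments.
Unset Strict Implicit.
Unset Printing Implicit Defensive.

Import GRing.Theory.
Local Open Scope ring_scope.
Local Open Scope quotient_scope.

Section LinearMaps.
Variables (k : fieldType) (U V : lmodType k).

Definition is_linear : {pred U -> V} := fun f => `[< linear f >].

Fact is_linear_submod : submod_closed is_linear.
Proof.
split.
  by apply/asboolP => a u v; rewrite /GRing.zero /= scaler0 addr0.
move=> a f g /asboolP lf /asboolP lg; apply/asboolP => b u v.
rewrite !fctE lf lg !scalerDr addrACA; congr (_ + _).
by congr (_ + _); rewrite !scalerA mulrC.
Qed.
HB.instance Definition _ :=
  GRing.isSubmodClosed.Build k (U -> V) is_linear is_linear_submod.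

Record LHom := LHomOf { hom_fun :> U -> V; hom_funP : hom_fun \in is_linear }.
HB.instance Definition _ := [isSub for hom_fun].
HB.instance Definition _ := [Choice of LHom by <:].
HB.instance Definition _ := [SubChoice_isSubLmodule of LHom by <:].

Lemma hom_linear (f : LHom) : linear f.
Proof. exact/asboolP/hom_funP. Qed.
HB.instance Definition _ (f : LHom) :=
  GRing.isLinear.Build k U V _ (hom_fun f) (hom_linear f).

Definition mkLHom (f : U -> V) (lf : linear f) : LHom := LHomOf (asboolT lf).

Lemma hom_ext (f g : LHom) : f =1 g -> f = g.
Proof. by move=> fg; apply/val_inj/funext. Qed.

Lemma addhE (f g : LHom) x : (f + g) x = f x + g x. Proof. by []. Qed.
Lemma scalehE a (f : LHom) x : (a *: f) x = a *: f x. Proof. by []. Qed.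
End LinearMaps.

Section HomOps.
Variables (k : fieldType).

Fact id_linear (U : lmodType k) : linear (fun x : U => x).
Proof. by []. Qed.
Definition idh U : LHom U U := mkLHom (@id_linear U).

Fact comp_linear (U V W : lmodType k) (g : LHom V W) (f : LHom U V) :
  linear (fun x => g (f x)).
Proof. by move=> a u v; rewrite !linearP. Qed.
Definition comph U V W g f : LHom U W := mkLHom (@comp_linear U V W g f).
End HomOps.

Notation "g \oh f" := (comph g f) (at level 50, left associativity).

Section Cokernel.
Variables (k : fieldType) (U V : lmodType k) (d : LHom U V).

Definition in_image : {pred V} := fun y => `[< exists x, y = d x >].

Fact in_image_submod : submod_closed in_image.
Proof.
split; first by apply/asboolP; exists 0; rewrite linear0.
move=> a _ _ /asboolP[x ->] /asboolP[y ->].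
by apply/asboolP; exists (a *: x + y); rewrite linearP.
Qed.
HB.instance Definition _ :=
  GRing.isSubmodClosed.Build k V in_image in_image_submod.

Definition coker : Type := Quotient.quot in_image.
HB.instance Definition _ := GRing.Zmodule.on coker.

Definition coker_pi (x : V) : coker := \pi_(Quotient.quot in_image) x.

Definition coker_scale (a : k) (x : coker) : coker :=
  coker_pi (a *: repr (x : Quotient.quot in_image)).

Lemma coker_piE x y : (coker_pi x == coker_pi y) = (x - y \in in_image).
Proof. by rewrite /coker_pi Quotient.idealrBE. Qed.

Lemma coker_reprK (x : coker) : coker_pi (repr (x : Quotient.quot in_image)) = x.
Proof. exact: reprK. Qed.

Fact coker_piD x y : coker_pi (x + y) = coker_pi x + coker_pi y.
Proof. exact: (raddfD (\pi_(Quotient.quot in_image))). Qed.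

Fact coker_piZ a x : coker_pi (a *: x) = coker_scale a (coker_pi x).
Proof.
apply/eqP; rewrite coker_piE -scalerBr rpredZ // -coker_piE.
by rewrite coker_reprK.
Qed.

Fact coker_scalerA a b v :
  coker_scale a (coker_scale b v) = coker_scale (a * b) v.
Proof. by rewrite -(coker_reprK v) -!coker_piZ scalerA. Qed.
Fact coker_scale1r : left_id 1 coker_scale.
Proof. by move=> v; rewrite -(coker_reprK v) -coker_piZ scale1r. Qed.
Fact coker_scalerDr : right_distributive coker_scale +%R.
Proof.
move=> a u v; rewrite -(coker_reprK u) -(coker_reprK v).
by rewrite -coker_piD -!coker_piZ -coker_piD scalerDr.
Qed.
Fact coker_scalerDl v : {morph coker_scale^~ v : a b / a + b}.
Proof.
by move=> a b; rewrite -(coker_reprK v) -!coker_piZ -coker_piD scalerDl.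
Qed.
HB.instance Definition _ := GRing.Zmodule_isLmodule.Build k coker
  coker_scalerA coker_scale1r coker_scalerDr coker_scalerDl.

Fact coker_pi_linear : linear coker_pi.
Proof. by move=> a x y; rewrite coker_piD coker_piZ. Qed.
Definition cokerh : LHom V coker := mkLHom coker_pi_linear.
End Cokernel.

Section Tensor.
Variables (k : fieldType) (U V : lmodType k).

(* A formal sum of pure tensors is a list of pairs; scalars are absorbed in   *)
(* the left factor. [tens_eq] is the congruence generated by the relations of *)
(* the tensor product.                                                        *)
Inductive tens_eq : seq (U * V) -> seq (U * V) -> Prop :=
| tens_eq_refl s : tens_eq s s
| tens_eq_sym s t : tens_eq s t -> tens_eq t s
| tens_eq_trans s t r : tens_eq s t -> tens_eq t r -> tens_eq s r
| tens_eq_cat s s' t t' :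
    tens_eq s s' -> tens_eq t t' -> tens_eq (s ++ t) (s' ++ t')
| tens_eq_catC s t : tens_eq (s ++ t) (t ++ s)
| tens_eq_0 v : tens_eq [:: (0, v)] [::]
| tens_eq_Dl u u' v : tens_eq [:: (u + u', v)] [:: (u, v); (u', v)]
| tens_eq_Dr u v v' : tens_eq [:: (u, v + v')] [:: (u, v); (u, v')]
| tens_eq_Z a u v : tens_eq [:: (a *: u, v)] [:: (u, a *: v)].

Definition tens_rel : rel (seq (U * V)) := fun s t => `[< tens_eq s t >].
Fact tens_rel_equiv : equiv_class_of tens_rel.
Proof.
split=> [s|s t|t s r].
- exact/asboolP/tens_eq_refl.
- by apply/idP/idP => /asboolP st; exact/asboolP/tens_eq_sym.
- by move=> /asboolP st /asboolP tr; exact/asboolP/(tens_eq_trans st tr).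
Qed.
Canonical tens_equiv := EquivRelPack tens_rel_equiv.
Canonical tens_encModRel := defaultEncModRel tens_rel.

Definition tens : Type := {eq_quot tens_rel}.
HB.instance Definition _ := Choice.on tens.

Definition tens_of (s : seq (U * V)) : tens := \pi_({eq_quot tens_rel}) s.
Definition tens_repr (t : tens) : seq (U * V) := repr (t : {eq_quot tens_rel}).

Lemma tens_reprK t : tens_of (tens_repr t) = t.
Proof. exact: reprK. Qed.
Lemma tens_ofP s t : tens_of s = tens_of t <-> tens_eq s t.
Proof.
split; first by move/eqP; rewrite /tens_of eqmodE => /asboolP.
by move=> st; apply/eqP; rewrite /tens_of eqmodE; apply/asboolP.
Qed.
Lemma repr_tens_of s : tens_eq (tens_repr (tens_of s)) s.
Proof. by apply/tens_ofP; rewrite tens_reprK. Qed.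

Definition scale_seq (a : k) (s : seq (U * V)) :=
  [seq (a *: p.1, p.2) | p <- s].

Fact scale_seq_eq a s t : tens_eq s t -> tens_eq (scale_seq a s) (scale_seq a t).
Proof.
elim=> {s t} //=.
- by move=> s; exact: tens_eq_refl.
- by move=> s t _ /tens_eq_sym.
- by move=> s t r _ st _; exact: tens_eq_trans.
- by move=> s s' t t' _ ss' _ tt'; rewrite /scale_seq !map_cat; exact: tens_eq_cat.
- by move=> s t; rewrite /scale_seq !map_cat; exact: tens_eq_catC.
- by move=> v; rewrite scaler0; exact: tens_eq_0.
- by move=> u u' v; rewrite scalerDr; exact: tens_eq_Dl.
- by move=> u v v'; exact: tens_eq_Dr.
- by move=> b u v; rewrite scalerA mulrC -scalerA; exact: tens_eq_Z.
Qed.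

Fact scale_seq0 s : tens_eq (scale_seq 0 s) [::].
Proof.
elim: s => [|[u v] s IH] /=; first exact: tens_eq_refl.
rewrite -[_ :: _]/([:: (0 *: u, v)] ++ scale_seq 0 s) -[[::]]/([::] ++ [::]).
by apply: tens_eq_cat => //; rewrite scale0r; exact: tens_eq_0.
Qed.

Fact scale_seqD a b s :
  tens_eq (scale_seq (a + b) s) (scale_seq a s ++ scale_seq b s).
Proof.
elim: s => [|[u v] s IH] /=; first exact: tens_eq_refl.
rewrite -cat1s -(cat1s (a *: u, v)) -(cat1s (b *: u, v)).
apply: (tens_eq_trans (tens_eq_cat (t' := scale_seq a s ++ scale_seq b s)
  (s' := [:: (a *: u, v)] ++ [:: (b *: u, v)]) _ IH)).
  by rewrite scalerDl; exact: tens_eq_Dl.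
rewrite -!catA; apply: tens_eq_cat; first exact: tens_eq_refl.
rewrite !catA; apply: tens_eq_cat; last exact: tens_eq_refl.
exact: tens_eq_catC.
Qed.

Definition tens_zero := tens_of [::].
Definition tens_add s t := tens_of (tens_repr s ++ tens_repr t).
Definition tens_scale a t := tens_of (scale_seq a (tens_repr t)).
Definition tens_opp t := tens_scale (-1) t.

Lemma tens_of_cat s t : tens_of (s ++ t) = tens_add (tens_of s) (tens_of t).
Proof. by apply/tens_ofP/tens_eq_sym/tens_eq_cat; exact: repr_tens_of. Qed.
Lemma tens_of_scale a s : tens_of (scale_seq a s) = tens_scale a (tens_of s).
Proof. exact/tens_ofP/scale_seq_eq/tens_eq_sym/repr_tens_of. Qed.

Fact tens_addA : associative tens_add.
Proof.
move=> s t r; rewrite -(tens_reprK s) -(tens_reprK t) -(tens_reprK r).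
by rewrite -!tens_of_cat catA.
Qed.
Fact tens_addC : commutative tens_add.
Proof. by move=> s t; apply/tens_ofP/tens_eq_catC. Qed.
Fact tens_add0 : left_id tens_zero tens_add.
Proof. by move=> s; rewrite -(tens_reprK s) -tens_of_cat. Qed.
Fact tens_scale1 : left_id 1 tens_scale.
Proof.
move=> s; rewrite -{2}(tens_reprK s) /tens_scale /scale_seq; congr tens_of.
by rewrite -[RHS]map_id; apply: eq_map => -[u v] /=; rewrite scale1r.
Qed.
Fact tens_scaleDl v a b :
  tens_scale (a + b) v = tens_add (tens_scale a v) (tens_scale b v).
Proof. by rewrite -tens_of_cat; exact/tens_ofP/scale_seqD. Qed.
Fact tens_addN : left_inverse tens_zero tens_opp tens_add.
Proof.
move=> s; rewrite -{2}[s]tens_scale1 -tens_scaleDl addNr.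
exact/tens_ofP/scale_seq0.
Qed.
HB.instance Definition _ := GRing.isZmodule.Build tens
  tens_addA tens_addC tens_add0 tens_addN.

Lemma tens_ofD s t : tens_of (s ++ t) = tens_of s + tens_of t.
Proof. exact: tens_of_cat. Qed.

Fact tens_scaleA a b v : tens_scale a (tens_scale b v) = tens_scale (a * b) v.
Proof.
rewrite -(tens_reprK v) -!tens_of_scale; congr tens_of.
by rewrite /scale_seq -map_comp; apply: eq_map => -[x y] /=; rewrite scalerA.
Qed.
Fact tens_scaleDr : right_distributive tens_scale +%R.
Proof.
move=> a s t; rewrite -(tens_reprK s) -(tens_reprK t) -tens_ofD.
by rewrite -!tens_of_scale -tens_ofD /scale_seq map_cat.
Qed.
HB.instance Definition _ := GRing.Zmodule_isLmodule.Build k tens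
  tens_scaleA tens_scale1 tens_scaleDr (fun v a b => tens_scaleDl v a b).

Definition tpure (u : U) (v : V) : tens := tens_of [:: (u, v)].

Lemma tens_of_sum s : tens_of s = \sum_(p <- s) tpure p.1 p.2.
Proof.
elim: s => [|[u v] s IH]; first by rewrite big_nil.
by rewrite big_cons -cat1s tens_ofD IH.
Qed.

Definition bilin (W : lmodType k) (B : U -> V -> W) :=
  (forall v, linear (B^~ v)) /\ (forall u, linear (B u)).

Lemma tpure_bilin : bilin tpure.
Proof.
split=> [v|u] a x y.
- rewrite [LHS](iffRL (tens_ofP _ _) (tens_eq_Dl _ _ _)) -cat1s tens_ofD.
  by congr (_ + _); rewrite -[RHS]tens_of_scale.
- rewrite [LHS](iffRL (tens_ofP _ _) (tens_eq_Dr _ _ _)) -cat1s tens_ofD.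
  congr (_ + _); rewrite -[RHS]tens_of_scale /=.
  exact/tens_ofP/tens_eq_sym/tens_eq_Z.
Qed.

Lemma tpure0l v : tpure 0 v = 0.
Proof. exact/tens_ofP/tens_eq_0. Qed.

(* For bilinear [B] this is the induced linear map; the value is then         *)
(* independent of the chosen representative of [t] (see [tlift_of]).          *)
Definition tlift (W : lmodType k) (B : U -> V -> W) (t : tens) : W :=
  \sum_(p <- tens_repr t) B p.1 p.2.

Section Lift.
Variables (W : lmodType k) (B : U -> V -> W).
Hypothesis bB : bilin B.

Let BlD v a x y : B (a *: x + y) v = a *: B x v + B y v.
Proof. exact: bB.1. Qed.
Let BrD u a x y : B u (a *: x + y) = a *: B u x + B u y.
Proof. exact: bB.2. Qed.
Let Bl0 v : B 0 v = 0.
Proof. by have := BlD v (-1) 0 0; rewrite scaler0 addr0 scaleN1r addNr. Qed.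
Let Br0 u : B u 0 = 0.
Proof. by have := BrD u (-1) 0 0; rewrite scaler0 addr0 scaleN1r addNr. Qed.

Fact tens_eq_sum s t : tens_eq s t ->
  \sum_(p <- s) B p.1 p.2 = \sum_(p <- t) B p.1 p.2.
Proof.
elim=> {s t} //.
- by move=> s t r _ -> _ ->.
- by move=> s s' t t' _ ss' _ tt'; rewrite !big_cat /= ss' tt'.
- by move=> s t; rewrite !big_cat /= addrC.
- by move=> v; rewrite big_seq1 big_nil Bl0.
- move=> u u' v; rewrite big_seq1 !big_cons big_nil addr0 /=.
  by rewrite -[u]scale1r BlD !scale1r.
- move=> u v v'; rewrite big_seq1 !big_cons big_nil addr0 /=.
  by rewrite -[v]scale1r BrD !scale1r.
- move=> a u v; rewrite !big_seq1 /=.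
  by rewrite -[a *: u]addr0 -[a *: v]addr0 BlD BrD Bl0 Br0.
Qed.

Lemma tlift_of s : tlift B (tens_of s) = \sum_(p <- s) B p.1 p.2.
Proof. exact/tens_eq_sum/repr_tens_of. Qed.

Lemma tlift_pure u v : tlift B (tpure u v) = B u v.
Proof. by rewrite tlift_of big_seq1. Qed.

Lemma tlift_linear : linear (tlift B).
Proof.
move=> a s t; rewrite -(tens_reprK s) -(tens_reprK t).
rewrite -[a *: _]/(tens_scale a _) -tens_of_scale -tens_ofD.
rewrite !tlift_of big_cat big_map scaler_sumr /=; congr (_ + _).
by apply: eq_bigr => p _; rewrite -[a *: p.1]addr0 BlD Bl0 addr0.
Qed.

Definition tlifth : LHom tens W := mkLHom tlift_linear.
End Lift.
End Tensor.

Notation "u \ot v" := (tpure u v) (at level 40, left associativity).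

(* A family of linear maps indexed by a tensor sums to a linear map.          *)
Fact tlift_param_linear (k : fieldType) (U V X W : lmodType k)
    (B : U -> V -> X -> W) (t : tens U V) :
  (forall u v, linear (B u v)) -> linear (fun x => tlift (fun u v => B u v x) t).
Proof.
move=> lB a x y; rewrite /tlift scaler_sumr -big_split /=.
by apply: eq_bigr => p _; rewrite lB.
Qed.

Section TensorOps.
Variables (k : fieldType).

Fact tmap_bilin (U V U' V' : lmodType k) (f : LHom U U') (g : LHom V V') :
  bilin (fun u v => f u \ot g v).
Proof.
by split=> [v|u] a x y; rewrite linearP; [apply: (tpure_bilin _ _).1|apply: (tpure_bilin _ _).2].
Qed.
Definition tmap U V U' V' f g : LHom (tens U V) (tens U' V') :=
  tlifth (@tmap_bilin U V U' V' f g).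

Variables U V W : lmodType k.

Fact tpure_linear_r (u : U) : linear (fun v : V => u \ot v).
Proof. exact: (tpure_bilin U V).2. Qed.
Definition tpureh u : LHom V (tens U V) := mkLHom (tpure_linear_r u).

Fact tassoc_bilin :
  bilin (fun (t : tens U V) (w : W) => tlift (fun u v => u \ot (v \ot w)) t).
Proof.
split=> [w|t].
  apply: tlift_linear; split=> [v|u] a x y; first exact: (tpure_bilin _ _).1.
  by rewrite (tpure_bilin V W).1 (tpure_bilin _ _).2.
apply: tlift_param_linear => u v a x y.
by rewrite (tpure_bilin V W).2 (tpure_bilin _ _).2.
Qed.
Definition tassoc : LHom (tens (tens U V) W) (tens U (tens V W)) :=
  tlifth tassoc_bilin.

Fact curry_linear (f : LHom (tens U V) W) : linear (fun u => f \oh tpureh u).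
Proof.
move=> a x y; apply: hom_ext => v; rewrite addhE scalehE /=.
by rewrite (tpure_bilin U V).1 linearP.
Qed.
Definition curryh f : LHom U (LHom V W) := mkLHom (curry_linear f).
End TensorOps.

Record hopfAlgebra (k : fieldType) := HopfAlgebra {
  hopf_alg :> algType k;
  comul : LHom hopf_alg (tens hopf_alg hopf_alg);
  counit : LHom hopf_alg k^o;
  antipode : LHom hopf_alg hopf_alg;
  comulA : forall h,
    tassoc _ _ _ (tmap comul (idh _) (comul h)) = tmap (idh _) comul (comul h);
  counitl : forall h, tlift (fun a b => counit a *: b) (comul h) = h;
  counitr : forall h, tlift (fun a b => counit b *: a) (comul h) = h;
  comul1 : comul 1 = 1 \ot 1;
  comulM : forall x y, comul (x * y) =
    tlift (fun a b => tlift (fun c d => (a * c) \ot (b * d)) (comul y)) (comul x);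
  counit1 : counit 1 = 1;
  counitM : forall x y, counit (x * y) = counit x * counit y;
  antipodel : forall h, tlift (fun a b => antipode a * b) (comul h) = counit h *: 1;
  antipoder : forall h, tlift (fun a b => a * antipode b) (comul h) = counit h *: 1
}.

Record invHopfAlgebra (k : fieldType) := InvHopfAlgebra {
  inv_hopf :> hopfAlgebra k;
  antipodeV : inv_hopf -> inv_hopf;
  antipodeK : cancel (antipode inv_hopf) antipodeV;
  antipodeVK : cancel antipodeV (antipode inv_hopf)
}.

Section HopfModules.
Variables (k : fieldType) (H : invHopfAlgebra k).

Definition Spow (j : int) (h : H) : H :=
  match j with
  | Posz n => iter n (antipode H) h
  | Negz n => iter n.+1 (@antipodeV k H) h
  end.

(* Sweedler sums: [sw2 T h] is T(h^1, h^2), and [sw3 T h] is T(h^1, h^2, h^3) *)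
(* computed with (Delta \otimes 1) Delta(h).                                  *)
Definition sw2 (W : lmodType k) (T : H -> H -> W) (h : H) : W :=
  tlift T (comul H h).
Definition sw3 (W : lmodType k) (T : H -> H -> H -> W) (h : H) : W :=
  sw2 (fun x c => sw2 (fun a b => T a b c) x) h.

Record hmodule_on (M : lmodType k) := HModule {
  hact : H -> M -> M;
  hact_bilin : bilin hact;
  hact1 : forall m, hact 1 m = m;
  hactM : forall g h m, hact (g * h) m = hact g (hact h m)
}.

Record hcomodule_on (M : lmodType k) := HComodule {
  hcoact : LHom M (tens M H);
  hcoactA : forall m,
    tassoc _ _ _ (tmap hcoact (idh _) (hcoact m)) = tmap (idh _) (comul H) (hcoact m);
  hcoact_counit : forall m, tlift (fun m0 m1 => counit H m1 *: m0) (hcoact m) = m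
}.

Fact counit_scale_linear (N : lmodType k) (n : N) :
  linear (fun h : H => (counit H h : k) *: n).
Proof. by move=> a x y; rewrite linearP scalerDl scalerA. Qed.
Definition counit_scale N n : LHom H N := mkLHom (@counit_scale_linear N n).

Record hcontramodule_on (N : lmodType k) := HContramodule {
  hcontra : LHom (LHom H N) N;
  hcontraA : forall f : LHom (tens H H) N,
    hcontra (hcontra \oh curryh f) = hcontra (f \oh comul H);
  hcontra_counit : forall n, hcontra (counit_scale n) = n
}.

Record YDmod_on (j : int) (M : lmodType k) := YDModOn {
  ydm_mod :> hmodule_on M;
  ydm_comod :> hcomodule_on M;
  ydm_compat : forall h m,
    hcoact ydm_comod (hact ydm_mod h m) =
    sw3 (fun h1 h2 h3 =>
      tlift (fun m0 m1 =>
        hact ydm_mod h2 m0 \ot (h3 * m1 * Spow (-1 - 2 * j) h1))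
      (hcoact ydm_comod m)) h
}.

Fact twist_linear (N : lmodType k) (A : hmodule_on N) (p : int) (h : H)
    (f : LHom H N) :
  linear (fun x : H =>
    sw3 (fun h1 h2 h3 => hact A h2 (f (antipode H h3 * x * Spow p h1))) h).
Proof.
apply: tlift_param_linear => x c; apply: tlift_param_linear => a b.
move=> r y z; rewrite mulrDr mulrDl -scalerAr -scalerAl linearP.
exact: (hact_bilin A).2.
Qed.
(* The map h^2 f(S(h^3) - S^p(h^1)).                                          *)
Definition twist N A p h f : LHom H N := mkLHom (@twist_linear N A p h f).

Record YDctr_on (j : int) (N : lmodType k) := YDCtrOn {
  ydc_mod :> hmodule_on N;
  ydc_contra :> hcontramodule_on N;
  ydc_compat : forall h (f : LHom H N),
    hact ydc_mod h (hcontra ydc_contra f) =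
    hcontra ydc_contra (twist ydc_mod (2 - 2 * j) h f)
}.

Record YDmod (j : int) :=
  YDMod { ydm_sort :> lmodType k; ydm_on :> YDmod_on j ydm_sort }.
Record YDctr (j : int) :=
  YDCtr { ydc_sort :> lmodType k; ydc_on :> YDctr_on j ydc_sort }.

Record YDmod_hom j (M M' : YDmod j) := YDModHom {
  ydm_map :> LHom M M';
  ydm_map_act : forall h m, ydm_map (hact M h m) = hact M' h (ydm_map m);
  ydm_map_coact : forall m,
    hcoact M' (ydm_map m) = tmap ydm_map (idh H) (hcoact M m)
}.

Record YDctr_hom j (N N' : YDctr j) := YDCtrHom {
  ydc_map :> LHom N N';
  ydc_map_act : forall h n, ydc_map (hact N h n) = hact N' h (ydc_map n);
  ydc_map_contra : forall f : LHom H N,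
    ydc_map (hcontra N f) = hcontra N' (ydc_map \oh f)
}.

Section Hat.
Variables (M : lmodType k) (rho : hcomodule_on M).

Definition is_colinear : {pred LHom H M} :=
  fun f => `[< forall x, hcoact rho (f x) = tmap f (idh H) (comul H x) >].

Fact is_colinear_submod : submod_closed is_colinear.
Proof.
split.
  apply/asboolP => x; rewrite [LHS]linear0; symmetry; apply: big1 => p _.
  exact: tpure0l.
move=> a f g /asboolP cf /asboolP cg; apply/asboolP => x.
rewrite -[_ x in LHS]/(a *: f x + g x) hom_linear cf cg /= /tlift scaler_sumr.
rewrite -big_split /=; apply: eq_bigr => p _; symmetry.
exact: (tpure_bilin _ _).1.
Qed.
HB.instance Definition _ :=
  GRing.isSubmodClosed.Build k (LHom H M) is_colinear is_colinear_submod.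

Record hat := HatOf { hat_hom :> LHom H M; hat_homP : hat_hom \in is_colinear }.
HB.instance Definition _ := [isSub for hat_hom].
HB.instance Definition _ := [Choice of hat by <:].
HB.instance Definition _ := [SubChoice_isSubLmodule of hat by <:].
End Hat.

Section Prime.
Variables (N : lmodType k) (alpha : hcontramodule_on N).

Definition odot_lhs : LHom (tens H (LHom H N)) (tens H N) :=
  tmap (idh H) (hcontra alpha).

Fact odot_rhs_bilin :
  bilin (fun (h : H) (f : LHom H N) => sw2 (fun h1 h2 => h2 \ot f h1) h).
Proof.
split=> [f a x y|h].
  rewrite /sw2 linearP; apply: tlift_linear; split=> [v|u] b z w.
    by rewrite linearP (tpure_bilin _ _).2.
  exact: (tpure_bilin _ _).1.
apply: tlift_param_linear => h1 h2 a f g.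
by rewrite addhE scalehE (tpure_bilin _ _).2.
Qed.
Definition odot_rhs : LHom (tens H (LHom H N)) (tens H N) :=
  tlifth odot_rhs_bilin.

Definition prime_of : lmodType k := coker (odot_lhs - odot_rhs).

Definition odot (x : H) (n : N) : prime_of :=
  cokerh (odot_lhs - odot_rhs) (x \ot n).
End Prime.

End HopfModules.

Record category := Category {
  ob :> Type;
  mor : ob -> ob -> Type;
  idm : forall x, mor x x;
  cmp : forall x y z, mor y z -> mor x y -> mor x z;
  cmp_idl : forall x y (f : mor x y), cmp (idm y) f = f;
  cmp_idr : forall x y (f : mor x y), cmp f (idm x) = f;
  cmpA : forall x y z t (h : mor z t) (g : mor y z) (f : mor x y),
    cmp h (cmp g f) = cmp (cmp h g) f
}.
Arguments mor {c}.
Arguments idm {c}.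
Arguments cmp {c x y z}.

Record functor_on (C D : category) (F : C -> D) := FunctorOn {
  fmor : forall x y, mor x y -> mor (F x) (F y);
  fmor_id : forall x, fmor (idm x) = idm (F x);
  fmor_cmp : forall x y z (g : mor y z) (f : mor x y),
    fmor (cmp g f) = cmp (fmor g) (fmor f)
}.
Arguments fmor {C D F} _ {x y}.

Definition left_adjoint (C D : category) (L0 : D -> C) (L : functor_on L0)
    (R0 : C -> D) (R : functor_on R0) : Prop :=
  exists phi : forall (d : D) (c : C), mor (L0 d) c -> mor d (R0 c),
  [/\ forall d c, bijective (phi d c),
      forall d d' c (u : mor d' d) (g : mor (L0 d) c),
        phi d' c (cmp g (fmor L u)) = cmp (phi d c g) u
    & forall d c c' (v : mor c c') (g : mor (L0 d) c),
        phi d c' (cmp v g) = cmp (fmor R v) (phi d c g)].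

Section YDCategories.
Variables (k : fieldType) (H : invHopfAlgebra k) (j : int).

Lemma YDmod_hom_ext (M M' : YDmod H j) (f g : YDmod_hom M M') : f =1 g -> f = g.
Proof.
move=> /hom_ext; case: f g => [f f1 f2] [g g1 g2] /= fg.
by case: g / fg in g1 g2 *; congr YDModHom; exact: Prop_irrelevance.
Qed.
Lemma YDctr_hom_ext (N N' : YDctr H j) (f g : YDctr_hom N N') : f =1 g -> f = g.
Proof.
move=> /hom_ext; case: f g => [f f1 f2] [g g1 g2] /= fg.
by case: g / fg in g1 g2 *; congr YDCtrHom; exact: Prop_irrelevance.
Qed.

Lemma tmap_id (U V : lmodType k) (t : tens U V) : tmap (idh U) (idh V) t = t.
Proof. by rewrite /= /tlift -tens_of_sum tens_reprK. Qed.
Lemma tmap_comp (U V U' V' U'' V'' : lmodType k) (f : LHom U U') (g : LHom V V')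
    (f' : LHom U' U'') (g' : LHom V' V'') (t : tens U V) :
  tmap f' g' (tmap f g t) = tmap (f' \oh f) (g' \oh g) t.
Proof.
rewrite -(tens_reprK t) [tmap f g _](tlift_of (tmap_bilin f g)).
rewrite [RHS](tlift_of (tmap_bilin _ _)) linear_sum; apply: eq_bigr => p _.
exact: (tlift_pure (tmap_bilin f' g')).
Qed.

Fact YDmod_id_act (M : YDmod H j) h m : idh M (hact M h m) = hact M h (idh M m).
Proof. by []. Qed.
Fact YDmod_id_coact (M : YDmod H j) m :
  hcoact M (idh M m) = tmap (idh M) (idh H) (hcoact M m).
Proof. by rewrite tmap_id. Qed.
Definition YDmod_id M : YDmod_hom M M :=
  YDModHom (@YDmod_id_act M) (@YDmod_id_coact M).

Fact YDmod_cmp_act (M1 M2 M3 : YDmod H j) (g : YDmod_hom M2 M3)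
    (f : YDmod_hom M1 M2) h m :
  (g \oh f) (hact M1 h m) = hact M3 h ((g \oh f) m).
Proof. by rewrite /= !ydm_map_act. Qed.
Fact YDmod_cmp_coact (M1 M2 M3 : YDmod H j) (g : YDmod_hom M2 M3)
    (f : YDmod_hom M1 M2) m :
  hcoact M3 ((g \oh f) m) = tmap (g \oh f) (idh H) (hcoact M1 m).
Proof.
rewrite [in LHS]/= !ydm_map_coact tmap_comp.
by congr (hom_fun (tmap _ _) _); apply: hom_ext.
Qed.
Definition YDmod_cmp M1 M2 M3 g f : YDmod_hom M1 M3 :=
  YDModHom (@YDmod_cmp_act M1 M2 M3 g f) (@YDmod_cmp_coact M1 M2 M3 g f).

Definition YDmod_cat : category.
Proof.
refine (@Category (YDmod H j) (@YDmod_hom k H j) YDmod_id YDmod_cmp _ _ _).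
- by move=> x y f; apply: YDmod_hom_ext.
- by move=> x y f; apply: YDmod_hom_ext.
- by move=> *; apply: YDmod_hom_ext.
Defined.

Fact YDctr_id_act (N : YDctr H j) h n : idh N (hact N h n) = hact N h (idh N n).
Proof. by []. Qed.
Fact YDctr_id_contra (N : YDctr H j) (f : LHom H N) :
  idh N (hcontra N f) = hcontra N (idh N \oh f).
Proof. by rewrite [LHS]/=; congr (hom_fun _ _); apply: hom_ext. Qed.
Definition YDctr_id N : YDctr_hom N N :=
  YDCtrHom (@YDctr_id_act N) (@YDctr_id_contra N).

Fact YDctr_cmp_act (N1 N2 N3 : YDctr H j) (g : YDctr_hom N2 N3)
    (f : YDctr_hom N1 N2) h n :
  (g \oh f) (hact N1 h n) = hact N3 h ((g \oh f) n).
Proof. by rewrite /= !ydc_map_act. Qed.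
Fact YDctr_cmp_contra (N1 N2 N3 : YDctr H j) (g : YDctr_hom N2 N3)
    (f : YDctr_hom N1 N2) (u : LHom H N1) :
  (g \oh f) (hcontra N1 u) = hcontra N3 ((g \oh f) \oh u).
Proof.
rewrite [LHS]/= !ydc_map_contra.
by congr (hom_fun _ _); apply: hom_ext.
Qed.
Definition YDctr_cmp N1 N2 N3 g f : YDctr_hom N1 N3 :=
  YDCtrHom (@YDctr_cmp_act N1 N2 N3 g f) (@YDctr_cmp_contra N1 N2 N3 g f).

Definition YDctr_cat : category.
Proof.
refine (@Category (YDctr H j) (@YDctr_hom k H j) YDctr_id YDctr_cmp _ _ _).
- by move=> x y f; apply: YDctr_hom_ext.
- by move=> x y f; apply: YDctr_hom_ext.
- by move=> *; apply: YDctr_hom_ext.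
Defined.
End YDCategories.

(* Main.v *)
Require Import Defs.
From HB Require Import structures.
From mathcomp Require Import all_boot all_order all_algebra.
From mathcomp Require Import boolp classical_sets functions.

Set Implicit Arguments.
Unset Strict Implicit.
Unset Printing Implicit Defensive.

Import GRing.Theory.
Local Open Scope ring_scope.

(* The antipode is an anti-automorphism of the algebra and of the coalgebra, so
   S^{-2i} is a bialgebra automorphism, and S^{-2i}(h^1) S^{1-2i}(h^2) = eps(h) =
   S^{1-2i}(h^1) S^{-2i}(h^2). Every verification then reduces, by coassociativity,
   to one of two patterns: the sums over (h^{11}, h^{12}, h^2, h^{31}, h^{32}) and
   over (h^1, h^{21}, h^{22}, h^{23}, h^3) agree, or the neighbours of a middle
   factor contract to counits on both of its sides. The adjunction sends
   g : N' -> M to n |-> (x |-> g(x (.) n)); it is inverted by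
   u |-> (x (.) n |-> u(n)(x)), which respects the defining relation of
   H (.)_H N because u commutes with the contraactions. *)

(** * Linearity rules and finite sums over tensors *)

Section Linearity.
Variable k : fieldType.

(** A head constant of its own, on which the tactics [lin1] and [linearity] match. *)
Definition lin (U V : lmodType k) (f : U -> V) : Prop := linear f.

Section LinTheory.
Variables U V W X Y : lmodType k.

Lemma lin_id : lin (fun x : U => x).
Proof. by []. Qed.

Lemma lin_comp (f : V -> W) (e : U -> V) : lin f -> lin e -> lin (fun x => f (e x)).
Proof. by move=> lf le a x y; rewrite le lf. Qed.

Lemma lin_hom (f : LHom V W) (e : U -> V) : lin e -> lin (fun x => f (e x)).
Proof. by move=> le a x y; rewrite le linearP. Qed.

Lemma lin_happ (e : U -> LHom V W) v : lin e -> lin (fun x => e x v).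
Proof. by move=> le a x y; rewrite le addhE scalehE. Qed.

Lemma lin_tpurel (e : U -> V) (w : W) : lin e -> lin (fun x => e x \ot w).
Proof. by move=> le a x y; rewrite le (tpure_bilin _ _).1. Qed.

Lemma lin_tpurer (v : V) (e : U -> W) : lin e -> lin (fun x => v \ot e x).
Proof. by move=> le a x y; rewrite le (tpure_bilin _ _).2. Qed.

Lemma lin_scalel (e : U -> k^o) (w : W) : lin e -> lin (fun x => (e x : k) *: w).
Proof. by move=> le a x y; rewrite le scalerDl scalerA. Qed.

Lemma lin_scaler c (e : U -> W) : lin e -> lin (fun x => c *: e x).
Proof. by move=> le a x y; rewrite le scalerDr !scalerA mulrC. Qed.

(** With the tensor fixed, [tlift] sums over one list representing it, and a sum of linear maps is
    linear. *)
Lemma lin_tlift_param (B : U -> V -> W -> X) t :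
  (forall v w, lin (fun x => B x v w)) -> lin (fun x => tlift (B x) t).
Proof.
move=> lB; apply: (@tlift_param_linear _ V W U X (fun v w x => B x v w)).
by move=> v w; apply: lB.
Qed.

(** Here the tensor varies, and its representative with it, whence the demand that [B] be linear in
    each argument. *)
Lemma lin_tlift_arg (B : V -> W -> X) (e : U -> tens V W) :
    (forall w, lin (fun v => B v w)) -> (forall v, lin (fun w => B v w)) -> lin e ->
  lin (fun x => tlift B (e x)).
Proof.
move=> l1 l2 le a x y; rewrite le; apply: tlift_linear; split.
- exact: l1.
- exact: l2.
Qed.

Lemma linD (f : U -> V) : lin f -> {morph f : x y / x + y}.
Proof. by move=> lf x y; rewrite -[x]scale1r lf !scale1r. Qed.

Lemma lin0 (f : U -> V) : lin f -> f 0 = 0.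
Proof. by move=> lf; exact: (linear0 (mkLHom lf)). Qed.

Lemma linZ (f : U -> V) a x : lin f -> f (a *: x) = a *: f x.
Proof. by move=> lf; rewrite -[a *: x]addr0 lf lin0 // addr0. Qed.

Lemma lin_tlift (f : X -> Y) (B : U -> V -> X) t : lin f ->
  f (tlift B t) = tlift (fun u v => f (B u v)) t.
Proof. by move=> lf; exact: (linear_sum (mkLHom lf)). Qed.

Lemma eq_tlift (B B' : U -> V -> X) t :
  (forall u v, B u v = B' u v) -> tlift B t = tlift B' t.
Proof. by move=> eB; apply: eq_bigr => p _. Qed.

(** An exchange of two finite sums over the chosen representatives. *)
Lemma tliftC (B : U -> V -> X -> Y -> W) s t :
  tlift (fun u v => tlift (fun x y => B u v x y) t) s =
  tlift (fun x y => tlift (fun u v => B u v x y) s) t.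
Proof. exact: exchange_big. Qed.

Lemma tlift_tpure (B : U -> V -> W) u v :
    (forall v, lin (fun u => B u v)) -> (forall u, lin (fun v => B u v)) ->
  tlift B (u \ot v) = B u v.
Proof. by move=> l1 l2; apply: tlift_pure; split. Qed.

Lemma tlift_id (t : tens U V) : tlift (fun u v => u \ot v) t = t.
Proof. by rewrite /tlift -tens_of_sum tens_reprK. Qed.

End LinTheory.

(** Every tensor is a sum of pure ones, by [tlift_id]. *)
Lemma tens_lin_ext (U V W : lmodType k) (f g : tens U V -> W) : lin f -> lin g ->
  (forall u v, f (u \ot v) = g (u \ot v)) -> f =1 g.
Proof.
move=> lf lg fg t; rewrite -(tlift_id t) (lin_tlift _ _ lf) (lin_tlift _ _ lg).
exact: eq_tlift.
Qed.

Lemma tmapE (U V U' V' : lmodType k) (f : LHom U U') (g : LHom V V') t :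
  tmap f g t = tlift (fun u v => f u \ot g v) t.
Proof. by []. Qed.

Lemma tassocE (U V W : lmodType k) (t : tens (tens U V) W) :
  tassoc U V W t = tlift (fun s w => tlift (fun u v => u \ot (v \ot w)) s) t.
Proof. by []. Qed.

Lemma lin_mull (U : lmodType k) (A : algType k) (e : U -> A) b :
  lin e -> lin (fun x => e x * b).
Proof. by move=> le a x y; rewrite le mulrDl scalerAl. Qed.

Lemma lin_mulr (U : lmodType k) (A : algType k) b (e : U -> A) :
  lin e -> lin (fun x => b * e x).
Proof. by move=> le a x y; rewrite le mulrDr scalerAr. Qed.

End Linearity.

(** * Linearity and exchange rules for Sweedler sums *)

Section Sweedler.
Variables (k : fieldType) (H : invHopfAlgebra k).
Implicit Types (h : H).

Lemma lin_hact (U M : lmodType k) (A : hmodule_on H M) h (e : U -> M) :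
  lin e -> lin (fun x => hact A h (e x)).
Proof. by move=> le a x y; rewrite le (hact_bilin A).2. Qed.

Lemma lin_hactl (U M : lmodType k) (A : hmodule_on H M) (e : U -> H) m :
  lin e -> lin (fun x => hact A (e x) m).
Proof. by move=> le a x y; rewrite le (hact_bilin A).1. Qed.

Lemma lin_hat (U M : lmodType k) (rho : hcomodule_on H M) (e : U -> hat rho) :
  lin e -> lin (fun x => hat_hom (e x)).
Proof. by move=> le a x y; rewrite le. Qed.

Lemma lin_odotl (U N : lmodType k) (alpha : hcontramodule_on H N) (e : U -> H) n :
  lin e -> lin (fun x => odot alpha (e x) n).
Proof. by move=> le; apply/lin_hom/lin_tpurel. Qed.

Lemma lin_odotr (U N : lmodType k) (alpha : hcontramodule_on H N) h (e : U -> N) :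
  lin e -> lin (fun x => odot alpha h (e x)).
Proof. by move=> le; apply/lin_hom/lin_tpurer. Qed.

Section Sw.
Variables U W : lmodType k.

Lemma lin_sw2p (B : U -> H -> H -> W) h :
  (forall a b, lin (fun u => B u a b)) -> lin (fun u => sw2 (B u) h).
Proof. exact: lin_tlift_param. Qed.

Lemma lin_sw2a (B : H -> H -> W) (e : U -> H) :
    (forall b, lin (fun a => B a b)) -> (forall a, lin (fun b => B a b)) -> lin e ->
  lin (fun x => sw2 B (e x)).
Proof. by move=> l1 l2 le; apply: lin_tlift_arg => //; apply: lin_hom. Qed.

End Sw.

Section Sw3.
Variables U V W : lmodType k.

Lemma lin_sw3p (B : U -> H -> H -> H -> W) h :
  (forall a b c, lin (fun x => B x a b c)) -> lin (fun x => sw3 (B x) h).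
Proof. by move=> lB; apply: lin_sw2p => y c; apply: lin_sw2p => a b; apply: lB. Qed.

Lemma lin_sw3a (B : H -> H -> H -> W) (e : U -> H) :
    (forall b c, lin (fun a => B a b c)) -> (forall a c, lin (fun b => B a b c)) ->
    (forall a b, lin (fun c => B a b c)) -> lin e ->
  lin (fun x => sw3 B (e x)).
Proof.
move=> l1 l2 l3 le; apply: lin_sw2a => // [c|x]; first exact: lin_sw2a.
exact: lin_sw2p.
Qed.

Lemma eq_sw2 (B B' : H -> H -> W) h : (forall a b, B a b = B' a b) -> sw2 B h = sw2 B' h.
Proof. exact: eq_tlift. Qed.

Lemma eq_sw3 (B B' : H -> H -> H -> W) h :
  (forall a b c, B a b c = B' a b c) -> sw3 B h = sw3 B' h.
Proof. by move=> eB; apply: eq_sw2 => a b; apply: eq_sw2. Qed.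

Lemma lin_sw2 (f : V -> W) (B : H -> H -> V) h : lin f ->
  f (sw2 B h) = sw2 (fun a b => f (B a b)) h.
Proof. exact: lin_tlift. Qed.

Lemma lin_sw3 (f : V -> W) (B : H -> H -> H -> V) h : lin f ->
  f (sw3 B h) = sw3 (fun a b c => f (B a b c)) h.
Proof. by move=> lf; rewrite /sw3 lin_sw2 //; apply: eq_sw2 => a b; rewrite lin_sw2. Qed.

Lemma sw2C (B : H -> H -> H -> H -> W) x y :
  sw2 (fun a b => sw2 (fun c d => B a b c d) y) x =
  sw2 (fun c d => sw2 (fun a b => B a b c d) x) y.
Proof. exact: tliftC. Qed.

Lemma sw2_sw3C (B : H -> H -> H -> H -> H -> W) (x y : H) :
  sw2 (fun a b => sw3 (fun c d e => B a b c d e) y) x =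
  sw3 (fun c d e => sw2 (fun a b => B a b c d e) x) y.
Proof. by rewrite [LHS]sw2C; apply: eq_sw2 => u e; rewrite sw2C. Qed.

Lemma sw3C (B : H -> H -> H -> H -> H -> H -> W) (x y : H) :
  sw3 (fun a b a' => sw3 (fun c d e => B a b a' c d e) y) x =
  sw3 (fun c d e => sw3 (fun a b a' => B a b a' c d e) x) y.
Proof. by rewrite -[RHS]sw2_sw3C; apply: eq_sw2 => u e; rewrite sw2_sw3C. Qed.
End Sw3.
End Sweedler.

(** * Automation of linearity goals *)

Ltac lin_comp_nonid e f :=
  lazymatch e with
  | (fun x => x) => fail
  | _ => apply: (@lin_comp _ _ _ _ f e)
  end.

(** One step of a syntax-directed search. A pattern variable such as [?c] cannot contain the bound
    variable, so the rule chosen is that of the argument where the variable occurs. The last case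
    eta-expands; [lin_comp_nonid] rejects the identity as inner map, which would only reproduce the
    goal. *)
Ltac lin1 :=
  lazymatch goal with
  | |- forall _, _ => intro
  | |- lin (fun x => x) => apply: lin_id
  | |- @lin _ ?U ?V ?f =>
    match goal with
    | |- lin (fun x => @?e x \ot ?c) => apply: (@lin_tpurel _ _ _ _ e c)
    | |- lin (fun x => ?c \ot @?e x) => apply: (@lin_tpurer _ _ _ _ c e)
    | |- lin (fun x => @?e x * ?c) => apply: (@lin_mull _ _ _ e c)
    | |- lin (fun x => ?c * @?e x) => apply: (@lin_mulr _ _ _ c e)
    | |- lin (fun x => @?e x *: ?c) => apply: (@lin_scalel _ _ _ e c)
    | |- lin (fun x => ?c *: @?e x) => apply: (@lin_scaler _ _ _ c e)
    | |- lin (fun x => hact ?A ?c (@?e x)) => apply: (@lin_hact _ _ _ _ A c e)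
    | |- lin (fun x => hact ?A (@?e x) ?m) => apply: (@lin_hactl _ _ _ _ A e m)
    | |- lin (fun x => hat_hom (@?e x)) => apply: (@lin_hat _ _ _ _ _ e)
    | |- lin (fun x => odot ?A (@?e x) ?c) => apply: (@lin_odotl _ _ _ _ A e c)
    | |- lin (fun x => odot ?A ?c (@?e x)) => apply: (@lin_odotr _ _ _ _ A c e)
    | |- lin (fun x => sw3 (@?B x) ?h) => apply: (@lin_sw3p _ _ _ _ B h)
    | |- lin (fun x => sw3 ?B (@?e x)) => apply: (@lin_sw3a _ _ _ _ B e)
    | |- lin (fun x => sw2 (@?B x) ?h) => apply: (@lin_sw2p _ _ _ _ B h)
    | |- lin (fun x => sw2 ?B (@?e x)) => apply: (@lin_sw2a _ _ _ _ B e)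
    | |- lin (fun x => tlift (@?B x) ?h) => apply: (@lin_tlift_param _ _ _ _ _ B h)
    | |- lin (fun x => tlift ?B (@?e x)) => apply: (@lin_tlift_arg _ _ _ _ _ B e)
    | |- lin (fun x => hom_fun ?f (@?e x)) => apply: (@lin_hom _ _ _ _ f e)
    | |- lin (fun x => hom_fun (@?e x) ?c) => apply: (@lin_happ _ _ _ _ e c)
    | |- lin (fun x => ?f (@?e x)) => lin_comp_nonid e f
    | |- lin (fun x => ?f (@?e x) ?a) => lin_comp_nonid e (fun y => f y a)
    | |- lin (fun x => ?f (@?e x) ?a ?b) => lin_comp_nonid e (fun y => f y a b)
    | |- lin (fun x => ?f (@?e x) ?a ?b ?c) => lin_comp_nonid e (fun y => f y a b c)
    | |- lin (fun x => ?f (@?e x) ?a ?b ?c ?d) => lin_comp_nonid e (fun y => f y a b c d)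
    | _ => lazymatch f with (fun x => _) => fail | _ => change (@lin _ U V (fun x => f x)) end
    end
  end; cbv beta.
Ltac linearity := cbv beta; solve [repeat (first [solve [auto] | lin1])].

(** * Sweedler calculus: coassociativity, counits and products *)

Section HopfCalculus.
Variables (k : fieldType) (H : invHopfAlgebra k).
Implicit Types (h : H).
Notation S := (antipode H).
Notation ep h := (counit H h : k).

(** Apply to both sides of [comulA] the linear map [G] that the trilinear [T] induces on H ⊗ (H ⊗
    H). *)
Lemma sw2A (W : lmodType k) (T : H -> H -> H -> W) h :
    (forall b c, lin (fun a => T a b c)) -> (forall a c, lin (fun b => T a b c)) ->
    (forall a b, lin (fun c => T a b c)) ->
  sw2 (fun a y => sw2 (fun b c => T a b c) y) h = sw3 T h.
Proof.
move=> l1 l2 l3.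
pose G := tlift (fun a (t : tens H H) => tlift (fun b c => T a b c) t).
have lG : lin G by rewrite /G; linearity.
transitivity (G (tmap (idh H) (comul H) (comul H h))).
  rewrite /= (lin_tlift _ _ lG); apply: eq_sw2 => a b.
  by rewrite /G tlift_tpure; linearity.
have lGA : lin (fun t => G (tassoc _ _ _ t)) by linearity.
rewrite -comulA [tmap _ _ _]/= (lin_tlift _ _ lGA).
apply: eq_sw2 => a b /=.
rewrite tlift_tpure; try by linearity.
rewrite (lin_tlift _ _ lG); apply: eq_sw2 => c d.
by rewrite /G !tlift_tpure //; linearity.
Qed.
Lemma tlift_sw2 (U V W : lmodType k) (T : U -> V -> W)
    (f : H -> H -> U) (g : H -> H -> V) h :
    (forall v, lin (fun u => T u v)) -> (forall u, lin (fun v => T u v)) ->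
  tlift T (sw2 (fun a b => f a b \ot g a b) h) = sw2 (fun a b => T (f a b) (g a b)) h.
Proof.
move=> l1 l2; rewrite (lin_sw2 (f := tlift T)); last by linearity.
by apply: eq_sw2 => a b; rewrite tlift_tpure.
Qed.

Lemma sw2_counitl (W : lmodType k) (T : H -> W) h : lin T ->
  sw2 (fun a b => ep a *: T b) h = T h.
Proof.
move=> lT; rewrite -[in RHS](counitl h) (lin_tlift _ _ lT).
by apply: eq_sw2 => a b; rewrite linZ.
Qed.

Lemma sw2_counitr (W : lmodType k) (T : H -> W) h : lin T ->
  sw2 (fun a b => ep b *: T a) h = T h.
Proof.
move=> lT; rewrite -[in RHS](counitr h) (lin_tlift _ _ lT).
by apply: eq_sw2 => a b; rewrite linZ.
Qed.

Lemma sw3_counit (W : lmodType k) (T : H -> W) h : lin T ->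
  sw3 (fun a b c => ep a *: (ep c *: T b)) h = T h.
Proof.
move=> lT; rewrite -[RHS]sw2_counitr //; apply: eq_sw2 => x c.
by rewrite (sw2_counitl (T := fun b => ep c *: T b)) //; linearity.
Qed.

Lemma sw2_1 (W : lmodType k) (T : H -> H -> W) :
    (forall b, lin (fun a => T a b)) -> (forall a, lin (fun b => T a b)) ->
  sw2 T 1 = T 1 1.
Proof. by move=> l1 l2; rewrite /sw2 comul1 tlift_tpure. Qed.

Lemma sw2M (W : lmodType k) (T : H -> H -> W) (x y : H) :
    (forall b, lin (fun a => T a b)) -> (forall a, lin (fun b => T a b)) ->
  sw2 T (x * y) = sw2 (fun a b => sw2 (fun c d => T (a * c) (b * d)) y) x.
Proof.
move=> l1 l2; have lT : lin (tlift T) by linearity.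
rewrite /sw2 comulM (lin_tlift _ _ lT); apply: eq_tlift => a b.
by rewrite (lin_tlift _ _ lT); apply: eq_tlift => c d; rewrite tlift_tpure.
Qed.

Lemma sw3_1 (W : lmodType k) (T : H -> H -> H -> W) :
    (forall b c, lin (fun a => T a b c)) -> (forall a c, lin (fun b => T a b c)) ->
    (forall a b, lin (fun c => T a b c)) ->
  sw3 T 1 = T 1 1 1.
Proof. by move=> l1 l2 l3; rewrite /sw3 sw2_1 ?sw2_1; linearity. Qed.

Lemma sw3M (W : lmodType k) (T : H -> H -> H -> W) (x y : H) :
    (forall b c, lin (fun a => T a b c)) -> (forall a c, lin (fun b => T a b c)) ->
    (forall a b, lin (fun c => T a b c)) ->
  sw3 T (x * y) =
  sw3 (fun a b c => sw3 (fun a' b' c' => T (a * a') (b * b') (c * c')) y) x.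
Proof.
move=> l1 l2 l3; rewrite [LHS]sw2M; try by linearity.
apply: eq_sw2 => u c; rewrite [RHS]sw2C; apply: eq_sw2 => u' c'.
by rewrite sw2M //; linearity.
Qed.

(** * Regrouping Sweedler factors and contracting neighbouring pairs *)

Section Regroup.
Variables (W : lmodType k) (F : H -> H -> H -> H -> H -> W).
Hypothesis l1 : forall b c d e, lin (fun a => F a b c d e).
Hypothesis l2 : forall a c d e, lin (fun b => F a b c d e).
Hypothesis l3 : forall a b d e, lin (fun c => F a b c d e).
Hypothesis l4 : forall a b c e, lin (fun d => F a b c d e).
Hypothesis l5 : forall a b c d, lin (fun e => F a b c d e).

(* Both sides are F(h^1, h^2, h^3, h^4, h^5). *)
Lemma sw5 h :
  sw3 (fun h1 h2 h3 => sw2 (fun p q => sw2 (fun r s => F p q h2 r s) h3) h1) h =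
  sw3 (fun h1 h2 h3 => sw3 (fun a b c => F h1 a b c h3) h2) h.
Proof.
rewrite -!sw2A; try by linearity.
(* Exchanging the sums lets the splitting of [h1] merge with the outer one, so that both sides share
   the first factor [p]. *)
transitivity (sw3 (fun p q y => sw2 (fun h2 h3 => sw2 (fun r s => F p q h2 r s) h3) y) h).
  by apply: eq_sw2 => h1 y; rewrite sw2C.
rewrite -sw2A; try by linearity.
apply: eq_sw2 => p y.
(* The common form has [q] and [s] at the ends and splits only the factor [z] between them. *)
transitivity (sw3 (fun q z s => sw2 (fun b r => F p q b r s) z) y).
  by rewrite -sw2A; try linearity; apply: eq_sw2 => q y'; rewrite sw2A; linearity.
by apply: eq_sw2 => h2 h3; rewrite -sw2A; linearity.
Qed.

(** By [sw5] the first two and the last two factors each form a coproduct of their own; both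
    contract to counits, which the middle factor absorbs. *)
Lemma sw_cancel (G : H -> W) h : lin G ->
    (forall x b y, sw2 (fun p q => sw2 (fun r s => F p q b r s) y) x =
                   ep x *: (ep y *: G b)) ->
  sw3 (fun h1 h2 h3 => sw3 (fun a b c => F h1 a b c h3) h2) h = G h.
Proof. by move=> lG FG; rewrite -sw5 -[RHS]sw3_counit //; apply: eq_sw3. Qed.
End Regroup.

(* The left-hand side is F(h^1, ..., h^7); the pairs (h^2, h^3) and (h^5, h^6)
   contract. *)
Lemma sw7_cancel (W : lmodType k) (F : H -> H -> H -> H -> H -> H -> H -> W)
    (G : H -> H -> H -> W) h :
    (forall q a b c r s, lin (fun p => F p q a b c r s)) ->
    (forall p a b c r s, lin (fun q => F p q a b c r s)) ->
    (forall p q b c r s, lin (fun a => F p q a b c r s)) ->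
    (forall p q a c r s, lin (fun b => F p q a b c r s)) ->
    (forall p q a b r s, lin (fun c => F p q a b c r s)) ->
    (forall p q a b c s, lin (fun r => F p q a b c r s)) ->
    (forall p q a b c r, lin (fun s => F p q a b c r s)) ->
    (forall p s, lin (fun b => G p b s)) ->
    (forall p s x b y, sw2 (fun q a => sw2 (fun c r => F p q a b c r s) y) x =
                   ep x *: (ep y *: G p b s)) ->
  sw3 (fun h1 h2 h3 => sw2 (fun p q => sw2 (fun r s =>
    sw3 (fun a b c => F p q a b c r s) h2) h3) h1) h = sw3 G h.
Proof.
move=> l1 l2 l3 l4 l5 l6 l7 lG FG.
(* With [h2] taken as one factor, [sw5] moves [p] and [s] to the outside; the five factors left
   inside fall under [sw_cancel]. *)
rewrite (sw5 (F := fun p q h2 r s => sw3 (fun a b c => F p q a b c r s) h2));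
  try by linearity.
apply: eq_sw3 => p h2 s.
by apply: (@sw_cancel _ (fun q a b c r => F p q a b c r s) _ _ _ _ _
  (fun b => G p b s)); linearity.
Qed.

(** * The antipode reverses products and coproducts *)

Lemma antipode1 : S 1 = 1 :> H.
Proof.
have := antipodel (1 : H); rewrite -[LHS]/(sw2 _ 1) sw2_1; try by linearity.
by rewrite mulr1 counit1 scale1r.
Qed.

Lemma sw2_antipodel h : sw2 (fun a b => S a * b) h = ep h *: 1.
Proof. exact: antipodel. Qed.

Lemma sw2_antipoder h : sw2 (fun a b => a * S b) h = ep h *: 1.
Proof. exact: antipoder. Qed.

(* S(xy) and S(y)S(x) are both convolution inverses of the product. *)
Lemma antipodeM (x y : H) : S (x * y) = S y * S x.
Proof.
(* [F] sums to S(x^1 y^1) x^2 y^2 S(y^3) S(x^3). Contracting from the left gives S(y) S(x), from the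
   right S(xy). *)
pose F a b b' c d d' : H := S (a * c) * (b * d) * (S d' * S b').
transitivity (sw3 (fun a b b' => sw3 (fun c d d' => F a b b' c d d') y) x); last first.
  transitivity (sw2 (fun u b' => sw2 (fun v d' =>
      (ep u * ep v) *: (S d' * S b')) y) x); last first.
    rewrite -[in RHS](sw2_counitl (T := fun b => S y * S b)); last by linearity.
    apply: eq_sw2 => u b'.
    rewrite -[in RHS](sw2_counitl (T := fun b => ep u *: (S b * S b'))); last by linearity.
    by apply: eq_sw2 => v d'; rewrite scalerA mulrC.
  apply: eq_sw2 => u b'; rewrite [LHS]sw2C; apply: eq_sw2 => v d'.
  rewrite /F -(counitM u v) -[in RHS](mul1r (S d' * S b')) scalerAl.
  rewrite -sw2_antipodel sw2M; try by linearity.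
  rewrite (lin_sw2 (f := fun z => z * (S d' * S b'))); last by linearity.
  apply: eq_sw2 => a b.
  by rewrite (lin_sw2 (f := fun z => z * (S d' * S b'))); last by linearity.
rewrite -sw2A; try (by rewrite /F; linearity).
rewrite -(sw2_counitr (T := fun a => S (a * y)) x); last by linearity.
apply: eq_sw2 => a u.
rewrite -(sw2_counitr (T := fun c => ep u *: S (a * c)) y); last by linearity.
transitivity (sw2 (fun b b' => sw2 (fun c v => sw2 (fun d d' =>
    F a b b' c d d') v) y) u); last first.
  by apply: eq_sw2 => b b'; rewrite sw2A // /F; linearity.
rewrite [RHS]sw2C; apply: eq_sw2 => c v; rewrite sw2C.
rewrite /F.
(* In b (d S(d')) S(b') the inner product contracts over [v], then the outer one over [u]. *)
transitivity (S (a * c) * (ep v *: sw2 (fun b b' => b * S b') u)).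
  by rewrite sw2_antipoder -!scalerAr mulr1.
rewrite (lin_sw2 (f := fun z => S (a * c) * (ep v *: z))); last by linearity.
rewrite sw2C; apply: eq_sw2 => b b'.
rewrite scalerAr -[in LHS](mul1r (S b')) scalerAl -sw2_antipoder.
rewrite (lin_sw2 (f := fun z => S (a * c) * (b * (z * S b')))); last by linearity.
by apply: eq_sw2 => d d'; rewrite !mulrA.
Qed.

(** The product of the algebra H ⊗ H, in the form in which [comulM] says that the coproduct is
    multiplicative. *)
Definition tmul (s t : tens H H) : tens H H :=
  tlift (fun a b => tlift (fun c d => (a * c) \ot (b * d)) t) s.

Lemma lin_tmull (U : lmodType k) (e : U -> tens H H) t :
  lin e -> lin (fun x => tmul (e x) t).
Proof. by move=> le; rewrite /tmul; linearity. Qed.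

Lemma lin_tmulr (U : lmodType k) (e : U -> tens H H) t :
  lin e -> lin (fun x => tmul t (e x)).
Proof. by move=> le; rewrite /tmul; linearity. Qed.

Lemma tmul_tpure (a b c d : H) : tmul (a \ot b) (c \ot d) = (a * c) \ot (b * d).
Proof. by rewrite /tmul tlift_tpure ?tlift_tpure; linearity. Qed.

Lemma tmulA s t u : tmul s (tmul t u) = tmul (tmul s t) u.
Proof.
move: s; apply: tens_lin_ext => [||a b].
- exact/lin_tmull/lin_id.
- exact/lin_tmull/lin_tmull/lin_id.
move: t; apply: tens_lin_ext => [||c d].
- exact/lin_tmulr/lin_tmull/lin_id.
- exact/lin_tmull/lin_tmulr/lin_id.
move: u; apply: tens_lin_ext => [||e f].
- exact/lin_tmulr/lin_tmulr/lin_id.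
- exact/lin_tmulr/lin_id.
by rewrite !tmul_tpure !mulrA.
Qed.

Lemma tmul1t t : tmul (1 \ot 1) t = t.
Proof.
move: t; apply: tens_lin_ext => [||a b]; first exact/lin_tmulr/lin_id.
- exact: lin_id.
- by rewrite tmul_tpure !mul1r.
Qed.

Lemma tmult1 t : tmul t (1 \ot 1) = t.
Proof.
move: t; apply: tens_lin_ext => [||a b]; first exact/lin_tmull/lin_id.
- exact: lin_id.
- by rewrite tmul_tpure !mulr1.
Qed.

(* Both sides are convolution inverses of the coproduct in Hom(H, H (x) H). *)
Lemma comul_antipode h : comul H (S h) = sw2 (fun a b => S b \ot S a) h.
Proof.
pose R h := sw2 (fun a b => S b \ot S a) h.
have lR : lin R by rewrite /R; linearity.
pose Q h := comul H (S h).
have lQ : lin Q by rewrite /Q; linearity.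
have ltl t : lin (fun s => tmul s t) by exact/lin_tmull/lin_id.
have ltr t : lin (fun s => tmul t s) by exact/lin_tmulr/lin_id.
(* [Q] is a left convolution inverse of the coproduct; by [DR], [R] is a right one. *)
have QD x : sw2 (fun a b => tmul (Q a) (comul H b)) x = ep x *: (1 \ot 1).
  under eq_sw2 => a b do rewrite -[tmul _ _]comulM.
  rewrite -(lin_sw2 (f := comul H)); last by linearity.
  by rewrite sw2_antipodel linearZ /= comul1.
have DR x : sw2 (fun a b => tmul (comul H a) (R b)) x = ep x *: (1 \ot 1).
  (* The sum is h^1 S(h^4) ⊗ h^2 S(h^3): the inner pair contracts first, then the outer one. *)
  transitivity (sw3 (fun p q b => sw2 (fun r s => (p * S s) \ot (q * S r)) b) x).
    apply: eq_sw2 => a b; apply: eq_tlift => p q.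
    by rewrite tlift_sw2; linearity.
  rewrite -sw2A; try by linearity.
  transitivity (sw2 (fun p y => (p * S y) \ot (1 : H)) x); last first.
    rewrite -(lin_sw2 (f := fun z => z \ot (1 : H))); last by linearity.
    rewrite sw2_antipoder (linZ (f := fun z => z \ot (1 : H))) //; linearity.
  apply: eq_sw2 => p y; rewrite sw2A; try by linearity.
  rewrite -[RHS](sw2_counitl (T := fun y => (p * S y) \ot (1 : H))); last by linearity.
  apply: eq_sw2 => z s; rewrite -(lin_sw2 (f := fun w => (p * S s) \ot w)); last by linearity.
  by rewrite sw2_antipoder (linZ (f := fun w => (p * S s) \ot w)) //; linearity.
rewrite -[LHS]/(Q h) -[RHS]/(R h).
have lM : forall a b, lin (fun c => tmul (Q a) (tmul (comul H b) (R c))) by linearity.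
(* Associativity of convolution identifies a left inverse with a right one: Q(h^1) Δ(h^2) R(h^3) is
   both Q(h) and R(h). *)
transitivity (sw3 (fun a b c => tmul (Q a) (tmul (comul H b) (R c))) h).
  rewrite -sw2A; try by linearity.
  rewrite -[LHS](sw2_counitr (T := Q)) //; apply: eq_sw2 => a u.
  rewrite -(lin_sw2 (f := tmul (Q a))); last exact: ltr.
  by rewrite DR (linZ _ _ (ltr _)) tmult1.
rewrite -[RHS](sw2_counitl (T := R)) //; apply: eq_sw2 => u c.
under eq_sw2 => a b do rewrite tmulA.
rewrite -(lin_sw2 (f := fun z => tmul z (R c))) //.
by rewrite QD (linZ _ _ (ltl _)) tmul1t.
Qed.

(** * Powers of the antipode: even ones preserve products and coproducts, odd ones reverse them *)

Record anti_endo (f : H -> H) : Prop := AntiEndo {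
  anti_lin : lin f;
  anti1 : f 1 = 1;
  antiM : forall x y, f (x * y) = f y * f x;
  anti_sw2 : forall (W : lmodType k) (T : H -> H -> W) h,
    (forall b, lin (fun a => T a b)) -> (forall a, lin (fun b => T a b)) ->
    sw2 T (f h) = sw2 (fun a b => T (f b) (f a)) h }.

(** Here and in [anti_endo], compatibility with the coproduct is stated against all bilinear [T],
    the form in which it rewrites a Sweedler sum. *)
Record bialg_endo (f : H -> H) : Prop := BialgEndo {
  endo_lin : lin f;
  endo1 : f 1 = 1;
  endoM : forall x y, f (x * y) = f x * f y;
  endo_sw2 : forall (W : lmodType k) (T : H -> H -> W) h,
    (forall b, lin (fun a => T a b)) -> (forall a, lin (fun b => T a b)) ->
    sw2 T (f h) = sw2 (fun a b => T (f a) (f b)) h }.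

Lemma antipode_anti : anti_endo S.
Proof.
split=> [|||W T h l1 l2]; [by linearity|exact: antipode1|exact: antipodeM|].
by rewrite {1}/sw2 comul_antipode tlift_sw2.
Qed.

(** Since S is injective, the identities can be checked after applying S; the one for coproducts is
    that of S read at [antipodeV h]. *)
Lemma antipodeV_anti : anti_endo (@antipodeV k H).
Proof.
have [lS S1 SM SD] := antipode_anti.
have SK := @antipodeK k H; have VK := @antipodeVK k H.
have lV : lin (@antipodeV k H).
  by move=> a x y; apply: (can_inj SK); rewrite lS !VK.
split=> [//|||W T h l1 l2].
- by apply: (can_inj SK); rewrite VK S1.
- by move=> x y; apply: (can_inj SK); rewrite SM !VK.
rewrite -[in RHS](VK h) SD; try by linearity.
by apply: eq_sw2 => a b; rewrite !SK.
Qed.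

Lemma anti_comp f g : anti_endo f -> anti_endo g -> bialg_endo (fun x => f (g x)).
Proof.
move=> [lf f1 fM fD] [lg g1 gM gD]; split=> [||x y|W T h l1 l2].
- by linearity.
- by rewrite g1 f1.
- by rewrite gM fM.
- by rewrite fD // gD; linearity.
Qed.

Lemma anti_endo_comp f g : anti_endo f -> bialg_endo g -> anti_endo (fun x => f (g x)).
Proof.
move=> [lf f1 fM fD] [lg g1 gM gD]; split=> [||x y|W T h l1 l2].
- by linearity.
- by rewrite g1 f1.
- by rewrite gM fM.
- by rewrite fD // gD; linearity.
Qed.

Lemma SpowD1 (j : int) h : Spow (j + 1) h = S (Spow j h).
Proof.
case: j => [n|[|n]]; first by rewrite -PoszD addn1.
- by rewrite /= antipodeVK.
- by rewrite NegzE intS opprD addrAC addNr add0r -[- _]/(Negz n) /= antipodeVK.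
Qed.

Lemma SpowB1 (j : int) h : Spow (j - 1) h = @antipodeV k H (Spow j h).
Proof. by rewrite -{2}(subrK 1 j) SpowD1 antipodeK. Qed.

Lemma Spow_antipode (j : int) h : Spow j (S h) = S (Spow j h).
Proof.
elim/int_rec: j => [//|n IH|n IH]; first by rewrite intS addrC !SpowD1 IH.
by rewrite intS opprD addrC !SpowB1 IH antipodeK antipodeVK.
Qed.

Lemma bialg_endo_ext f g : f =1 g -> bialg_endo f -> bialg_endo g.
Proof. by move=> /funext ->. Qed.

(** Each step in [m] composes with S twice or with its inverse twice, and the two reversals
    cancel. *)
Lemma Spow_even (m : int) : bialg_endo (Spow (2 * m)).
Proof.
have aS := antipode_anti; have aV := antipodeV_anti.
elim/int_rec: m => [|n [lE E1 EM ED]|n [lE E1 EM ED]].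
- by rewrite mulr0; split.
- apply: (bialg_endo_ext (f := fun x => S (S (Spow (2 * n%:Z) x)))).
    by move=> x; rewrite intS mulrDr addrC (_ : 2 * 1 = 1 + 1 :> int) // addrA !SpowD1.
  exact: (anti_comp aS (anti_endo_comp aS _)).
- apply: (bialg_endo_ext (f := fun x => antipodeV (antipodeV (Spow (2 * - n%:Z) x)))).
    by move=> x; rewrite intS opprD mulrDr addrC (_ : 2 * - 1 = - 1 - 1 :> int) // addrA !SpowB1.
  exact: (anti_comp aV (anti_endo_comp aV _)).
Qed.

Lemma Spow_odd (m : int) : anti_endo (Spow (2 * m + 1)).
Proof.
rewrite (_ : Spow _ = fun x => S (Spow (2 * m) x)); last by apply: funext => x; rewrite SpowD1.
exact: (anti_endo_comp antipode_anti (Spow_even m)).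
Qed.

(** S^{2m} is multiplicative and commutes with S, so the sum is S^{2m} applied to h^1 S(h^2); in
    [Spow_mul_odd_even] it is S^{2m} applied to S(h^1) h^2. *)
Lemma Spow_mul_even_odd (m : int) h :
  sw2 (fun a b => Spow (2 * m) a * Spow (2 * m + 1) b) h = ep h *: 1.
Proof.
have [lE E1 EM _] := Spow_even m.
under eq_sw2 => a b do rewrite SpowD1 -Spow_antipode -EM.
by rewrite -(lin_sw2 (f := Spow (2 * m))) // sw2_antipoder linZ // E1.
Qed.

Lemma Spow_mul_odd_even (m : int) h :
  sw2 (fun a b => Spow (2 * m + 1) a * Spow (2 * m) b) h = ep h *: 1.
Proof.
have [lE E1 EM _] := Spow_even m.
under eq_sw2 => a b do rewrite SpowD1 -Spow_antipode -EM.
by rewrite -(lin_sw2 (f := Spow (2 * m))) // sw2_antipodel linZ // E1.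
Qed.

End HopfCalculus.

(** * The universal property of the cokernel *)

Section CokernelLift.
Variables (k : fieldType) (U V W : lmodType k) (d : LHom U V) (g : LHom V W).
Hypothesis gd : forall u, g (d u) = 0.

Definition coker_lift_fun (x : coker d) : W := g (repr (x : Quotient.quot (in_image d))).

(** The chosen representative differs from [v] by an element of the image of [d], which [g]
    kills. *)
Lemma coker_lift_funE v : coker_lift_fun (coker_pi d v) = g v.
Proof.
have : coker_pi d (repr (coker_pi d v : Quotient.quot (in_image d))) == coker_pi d v.
  by rewrite coker_reprK.
rewrite coker_piE => /asboolP[u /eqP]; rewrite subr_eq => /eqP E.
by rewrite /coker_lift_fun E (linD (f := g) (hom_linear g)) gd add0r.
Qed.

Fact coker_lift_linear : linear coker_lift_fun.
Proof.
move=> a x y; rewrite -(coker_reprK x) -(coker_reprK y) -coker_pi_linear.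
by rewrite !coker_lift_funE linearP.
Qed.

Definition coker_lift : LHom (coker d) W := mkLHom coker_lift_linear.

Lemma coker_liftE v : coker_lift (cokerh d v) = g v.
Proof. exact: coker_lift_funE. Qed.
End CokernelLift.

(** * Relations, generators and universal property of H ⊙_H N *)

Section PrimeTheory.
Variables (k : fieldType) (H : invHopfAlgebra k) (N : lmodType k).
Variable alpha : hcontramodule_on H N.

(** The two sides come from tensors that differ by the image of x ⊗ f under the map whose cokernel
    is taken. *)
Lemma odot_contra (x : H) f :
  odot alpha x (hcontra alpha f) = sw2 (fun x1 x2 => odot alpha x2 (f x1)) x.
Proof.
transitivity (cokerh (odot_lhs alpha - odot_rhs H N) (sw2 (fun x1 x2 => x2 \ot f x1) x)).
  apply/eqP; rewrite [X in X == _]/= coker_piE; apply/asboolP.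
  exists (x \ot f); rewrite -[RHS]/(odot_lhs alpha (x \ot f) - odot_rhs H N (x \ot f)).
  rewrite /= tlift_tpure; try by linearity.
  by rewrite tlift_tpure; linearity.
by rewrite (lin_sw2 (f := cokerh _)) //; linearity.
Qed.

(** The classes x ⊙ n of pure tensors span H ⊙_H N. *)
Lemma prime_ext (W : lmodType k) (f g : prime_of alpha -> W) : lin f -> lin g ->
  (forall x n, f (odot alpha x n) = g (odot alpha x n)) -> f =1 g.
Proof.
move=> lf lg fg t; rewrite -(coker_reprK t).
move: (repr _) => v.
apply: (tens_lin_ext (f := fun v => f (cokerh _ v))
  (g := fun v => g (cokerh _ v))) => //; linearity.
Qed.

Section Lift.
Variables (W : lmodType k) (B : H -> N -> W).
Hypothesis l1 : forall n, lin (fun x => B x n).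
Hypothesis l2 : forall x, lin (fun n => B x n).
Hypothesis Bcontra : forall x f, B x (hcontra alpha f) = sw2 (fun x1 x2 => B x2 (f x1)) x.

Fact prime_lift_bilin : bilin B. Proof. by split=> [n|x]; [apply: l1|apply: l2]. Qed.

Fact prime_lift_rel u : tlifth prime_lift_bilin ((odot_lhs alpha - odot_rhs H N) u) = 0.
Proof.
move: u; apply: tens_lin_ext => [||x f].
- by linearity.
- by move=> a x y; rewrite scaler0 addr0.
have -> : (odot_lhs alpha - odot_rhs H N) (x \ot f) =
  odot_lhs alpha (x \ot f) - odot_rhs H N (x \ot f) by [].
rewrite linearB /=.
rewrite !(tlift_tpure (U := H)); try by linearity.
rewrite (lin_sw2 (f := tlift B)); last by linearity.
rewrite Bcontra; apply/eqP; rewrite subr_eq0; apply/eqP.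
by apply: eq_sw2 => a b; rewrite tlift_tpure.
Qed.

(** The universal property of H ⊙_H N: a bilinear map that respects the relation [odot_contra]
    descends. *)
Definition prime_lift : LHom (prime_of alpha) W := coker_lift prime_lift_rel.

Lemma prime_liftE x n : prime_lift (odot alpha x n) = B x n.
Proof. by rewrite [LHS]coker_liftE /= tlift_tpure. Qed.
End Lift.
End PrimeTheory.

(** * The twisting powers [E] (even) and [O] (odd) of the antipode and their cancellation *)

Section Twisted.
Variables (k : fieldType) (H : invHopfAlgebra k) (i : int).
Implicit Types (h x : H).
Notation S := (antipode H).
Notation ep h := (counit H h : k).
Notation E := (@Spow k H (- (2 * i))).
Notation O := (@Spow k H (1 - 2 * i)).

Lemma E_endo : bialg_endo E.
Proof. by rewrite -mulrN; apply: Spow_even. Qed.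

Lemma O_anti : anti_endo O.
Proof. by rewrite addrC -mulrN; apply: Spow_odd. Qed.

Lemma lin_E : lin E. Proof. by have [] := E_endo. Qed.
Lemma lin_O : lin O. Proof. by have [] := O_anti. Qed.
Hint Resolve lin_E lin_O : core.

Lemma sw2_EO h : sw2 (fun a b => E a * O b) h = ep h *: 1.
Proof. by rewrite [1 - _]addrC -mulrN Spow_mul_even_odd. Qed.

Lemma sw2_OE h : sw2 (fun a b => O a * E b) h = ep h *: 1.
Proof. by rewrite [1 - _]addrC -mulrN Spow_mul_odd_even. Qed.

Section Bilinear.
Variables (W : lmodType k) (T : H -> H -> W).
Hypothesis l1 : forall b, lin (fun a => T a b).
Hypothesis l2 : forall a, lin (fun b => T a b).

(** The coproduct is multiplicative, S reverses the factors of [c], and [E] keeps those of [a] in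
    order. In [sw2_xO] it is the right multiplier [O] that reverses. *)
Lemma sw2_SxE a x c : sw2 T (S c * x * E a) =
  sw2 (fun p q => sw2 (fun r s => sw2 (fun x1 x2 =>
    T (S s * x1 * E p) (S r * x2 * E q)) x) c) a.
Proof.
rewrite sw2M // sw2C (endo_sw2 E_endo); try by linearity.
apply: eq_sw2 => p q; rewrite sw2M; try by linearity.
by rewrite (anti_sw2 (antipode_anti H)); linearity.
Qed.

Lemma sw2_xO a x c : sw2 T (c * x * O a) =
  sw2 (fun p q => sw2 (fun r s => sw2 (fun x1 x2 =>
    T (r * x1 * O q) (s * x2 * O p)) x) c) a.
Proof.
rewrite sw2M // sw2C (anti_sw2 O_anti); try by linearity.
by apply: eq_sw2 => p q; rewrite sw2M; linearity.
Qed.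

(** Bilinearity pulls each sum into its own argument of [T]. The pair from [v] sits in the first
    argument because left multipliers stem from the last Sweedler factors and right multipliers from
    the first. *)
Lemma sw22_cancel (P Q : H -> H -> H) u v :
    sw2 P u = ep u *: 1 -> sw2 Q v = ep v *: 1 ->
  sw2 (fun q a => sw2 (fun c r => T (Q c r) (P q a)) v) u = ep u *: (ep v *: T 1 1).
Proof.
move=> Pu Qv.
transitivity (sw2 (fun q a => T (sw2 Q v) (P q a)) u).
  by apply: eq_sw2 => q a; rewrite (lin_sw2 (f := fun z => T z (P q a))).
rewrite -(lin_sw2 (f := T (sw2 Q v))) // Pu Qv (linZ _ _ (l2 _)); congr (_ *: _).
by rewrite (linZ (f := fun z => T z 1)).
Qed.
End Bilinear.

(** For j = i - 1 the exponent -1 - 2j is 1 - 2i. *)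
Lemma YDmod_coact (M : YDmod H (i - 1)) h (m : M) :
  hcoact M (hact M h m) = sw3 (fun h1 h2 h3 =>
    tlift (fun m0 m1 => hact M h2 m0 \ot (h3 * m1 * O h1)) (hcoact M m)) h.
Proof.
rewrite ydm_compat (_ : - 1 - 2 * (i - 1) = 1 - 2 * i) //.
by rewrite mulrBr opprB addrCA addrA.
Qed.

(** For j = i + 1 the exponent 2 - 2j is -2i. *)
Lemma YDctr_contra (N : YDctr H (i + 1)) h (f : LHom H N) :
  hact N h (hcontra N f) = hcontra N (twist N (- (2 * i)) h f).
Proof. by rewrite ydc_compat mulrDr opprD addrCA subrr addr0. Qed.

(** * The contramodule structure on the space of colinear maps H -> M *)

Section HatStructure.
Variable M : YDmod H (i - 1).

Lemma hat_ext (f g : hat M) : f =1 g -> f = g.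
Proof. by move=> fg; apply/val_inj/hom_ext. Qed.

Lemma hat_coact (f : hat M) x : hcoact M (f x) = sw2 (fun a b => f a \ot b) x.
Proof. by have /asboolP := hat_homP f; apply. Qed.

(** By the compatibility of [M], the coaction of the value at x is h^4 f(S(h^7) x^1 E(h^1)) ⊗ h^5
    S(h^6) x^2 E(h^2) O(h^3). The pairs (h^2, h^3) and (h^5, h^6) contract. *)
Fact twist_colinear h (f : hat M) : twist M (- (2 * i)) h f \in is_colinear M.
Proof.
apply/asboolP => x /=.
rewrite (lin_sw3 (f := hcoact M)); last by linearity.
transitivity (sw3 (fun h1 h2 h3 => sw2 (fun x1 x2 =>
    hact M h2 (f (S h3 * x1 * E h1)) \ot x2) x) h); last first.
  rewrite -sw2_sw3C; apply: eq_sw2 => x1 x2.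
  by rewrite (lin_sw3 (f := fun z => z \ot x2)); last by linearity.
(* The multipliers [z] and [w] are kept as arguments, so that [sw22_cancel] can replace both by
   1. *)
pose K p b s z w := sw2 (fun x1 x2 =>
  hact M b (f (S s * x1 * E p)) \ot (z * x2 * w)) x.
transitivity (sw3 (fun h1 h2 h3 => sw2 (fun p q => sw2 (fun r s =>
    sw3 (fun a b c => K p b s (c * S r) (E q * O a)) h2) h3) h1) h).
  apply: eq_sw3 => h1 h2 h3; rewrite YDmod_coact.
  under [RHS]eq_sw2 => p q do rewrite sw2_sw3C.
  rewrite sw2_sw3C; apply: eq_sw3 => a b c.
  rewrite hat_coact tlift_sw2; try by linearity.
  rewrite sw2_SxE; try by linearity.
  apply: eq_sw2 => p q; apply: eq_sw2 => r s; apply: eq_sw2 => x1 x2.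
  by rewrite !mulrA.
rewrite (sw7_cancel (F := fun p q a b c r s => K p b s (c * S r) (E q * O a))
  (G := fun p b s => K p b s 1 1)) /K; try by linearity.
  by apply: eq_sw3 => p b s; apply: eq_sw2 => x1 x2; rewrite mul1r mulr1.
move=> p s u b v; rewrite (sw22_cancel (T := K p b s)) ?sw2_EO ?sw2_antipoder // /K; linearity.
Qed.

Definition hat_act h (f : hat M) : hat M := HatOf (twist_colinear h f).

Lemma hat_actE h f x : hat_act h f x =
  sw3 (fun h1 h2 h3 => hact M h2 (f (S h3 * x * E h1))) h.
Proof. by []. Qed.

Fact hat_act_bilin : bilin hat_act.
Proof.
split=> [f|h] a u v; apply: hat_ext => x.
- suff: lin (fun h => sw3 (fun h1 h2 h3 => hact M h2 (f (S h3 * x * E h1))) h) by apply.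
  by linearity.
- suff: lin (fun f : hat M => sw3 (fun h1 h2 h3 => hact M h2 (f (S h3 * x * E h1))) h) by apply.
  by linearity.
Qed.

Fact hat_act1 f : hat_act 1 f = f.
Proof.
apply: hat_ext => x; rewrite hat_actE sw3_1; try by linearity.
by rewrite antipode1 (endo1 E_endo) hact1 mul1r mulr1.
Qed.

Fact hat_actM g h f : hat_act (g * h) f = hat_act g (hat_act h f).
Proof.
apply: hat_ext => x; rewrite !hat_actE sw3M; try by linearity.
apply: eq_sw3 => a b c; rewrite hat_actE (lin_sw3 (f := hact M b)); last by linearity.
apply: eq_sw3 => a' b' c'.
by rewrite hactM antipodeM (endoM E_endo) !mulrA.
Qed.

Definition hat_mod := HModule hat_act_bilin hat_act1 hat_actM.

Fact hat_contra_linear (theta : LHom H (hat M)) :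
  linear (fun h => sw2 (fun a b => theta a b) h).
Proof. by suff: lin (fun h => sw2 (fun a b => theta a b) h) by []; linearity. Qed.

(** Coassociativity, every value of [theta] being colinear. *)
Fact hat_contra_colinear (theta : LHom H (hat M)) :
  mkLHom (hat_contra_linear theta) \in is_colinear M.
Proof.
apply/asboolP => x /=; rewrite (lin_sw2 (f := hcoact M)); last by linearity.
under eq_sw2 => a b do rewrite hat_coact.
rewrite sw2A; try by linearity.
apply: eq_sw2 => a b.
by rewrite (lin_sw2 (f := fun z => z \ot b)); last by linearity.
Qed.

Definition hat_contra_fun theta : hat M := HatOf (hat_contra_colinear theta).

Fact hat_contra_fun_linear : linear hat_contra_fun.
Proof.
move=> a u v; apply: hat_ext => x.
suff: lin (fun t : LHom H (hat M) => sw2 (fun c b => t c b) x) by apply.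
by linearity.
Qed.

Definition hat_contra : LHom (LHom H (hat M)) (hat M) := mkLHom hat_contra_fun_linear.

Lemma hat_contraE theta x : hat_contra theta x = sw2 (fun a b => theta a b) x.
Proof. by []. Qed.

Fact hat_contraA (f : LHom (tens H H) (hat M)) :
  hat_contra (hat_contra \oh curryh f) = hat_contra (f \oh comul H).
Proof.
apply: hat_ext => x; rewrite !hat_contraE /=.
rewrite [LHS]sw2A; try by linearity.
apply: eq_sw2 => a b.
rewrite -[in RHS](tlift_id (comul H a)) (lin_tlift (f := fun t => f t b)) //; linearity.
Qed.

Fact hat_contra_counit n : hat_contra (counit_scale H n) = n.
Proof.
apply: hat_ext => x; rewrite hat_contraE.
rewrite -[RHS](sw2_counitl (T := fun x => n x)); last by linearity.
by apply: eq_sw2.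
Qed.

Definition hat_contramod := HContramodule hat_contraA hat_contra_counit.

(** At x both sides are h^3 θ(S(h^5) x^1 E(h^1))(S(h^4) x^2 E(h^2)), written θ for [theta]; [sw5]
    matches the two groupings. *)
Fact hat_compat h (theta : LHom H (hat M)) :
  hact hat_mod h (hcontra hat_contramod theta) =
  hcontra hat_contramod (twist hat_mod (2 - 2 * (i + 1)) h theta).
Proof.
rewrite (_ : 2 - 2 * (i + 1) = - (2 * i)); last by rewrite mulrDr opprD addrCA subrr addr0.
apply: hat_ext => x; rewrite [LHS]hat_actE [RHS]hat_contraE.
under eq_sw3 => h1 h2 h3.
  rewrite hat_contraE (lin_sw2 (f := hact M h2)); last by linearity.
  rewrite sw2_SxE; try by linearity.
  over.
rewrite (sw5 (F := fun p q b r s => sw2 (fun x1 x2 =>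
  hact M b (theta (S s * x1 * E p) (S r * x2 * E q))) x)); try by linearity.
transitivity (sw2 (fun x1 x2 => sw3 (fun h1 h2 h3 => sw3 (fun a b c =>
  hact M b (theta (S h3 * x1 * E h1) (S c * x2 * E a))) h2) h) x); last first.
  apply: eq_sw2 => x1 x2 /=.
  rewrite (lin_sw3 (f := fun z : hat M => z x2)); last by linearity.
  by apply: eq_sw3.
rewrite sw2_sw3C; apply: eq_sw3 => h1 h2 h3.
by rewrite sw2_sw3C.
Qed.

Definition hat_YDctr : YDctr_on H (i + 1) (hat M) := YDCtrOn hat_compat.
End HatStructure.

(** * The module and comodule structure on H ⊙_H N *)

Section PrimeStructure.
Variable N : YDctr H (i + 1).

Definition prime_act_on h x (n : N) : prime_of N :=
  sw3 (fun h1 h2 h3 => odot N (h3 * x * O h1) (hact N h2 n)) h.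

Fact prime_act_on_linl h n : lin (fun x => prime_act_on h x n).
Proof. by rewrite /prime_act_on; linearity. Qed.

Fact prime_act_on_linr h x : lin (fun n => prime_act_on h x n).
Proof. by rewrite /prime_act_on; linearity. Qed.

(** This lets the action descend to H ⊙_H N. The left side expands to h^7 x^2 O(h^1) ⊙ h^4 f(S(h^5)
    h^6 x^1 O(h^2) E(h^3)), where (h^2, h^3) and (h^5, h^6) contract. *)
Fact prime_act_on_contra h x (f : LHom H N) :
  prime_act_on h x (hcontra N f) = sw2 (fun x1 x2 => prime_act_on h x2 (f x1)) x.
Proof.
pose K p b s z w := sw2 (fun x1 x2 =>
  odot N (s * x2 * O p) (hact N b (f (z * x1 * w)))) x.
transitivity (sw3 (fun h1 h2 h3 => sw2 (fun p q => sw2 (fun r s =>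
    sw3 (fun a b c => K p b s (S c * r) (O q * E a)) h2) h3) h1) h).
  apply: eq_sw3 => h1 h2 h3; rewrite YDctr_contra odot_contra sw2_xO; try by linearity.
  apply: eq_sw2 => p q; apply: eq_sw2 => r s; rewrite -sw2_sw3C; apply: eq_sw2 => x1 x2 /=.
  rewrite (lin_sw3 (f := odot N (s * x2 * O p))); last by linearity.
  by apply: eq_sw3 => a b c; rewrite !mulrA.
rewrite (sw7_cancel (F := fun p q a b c r s => K p b s (S c * r) (O q * E a))
  (G := fun p b s => K p b s 1 1)) /K; try by linearity.
  rewrite /prime_act_on sw2_sw3C.
  by apply: eq_sw3 => p b s; apply: eq_sw2 => x1 x2; rewrite mul1r mulr1.
move=> p s u b v; rewrite (sw22_cancel (T := K p b s)) ?sw2_OE ?sw2_antipodel // /K; linearity.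
Qed.

Definition prime_act h : LHom (prime_of N) (prime_of N) :=
  prime_lift (prime_act_on_linl h) (prime_act_on_linr h) (prime_act_on_contra h).

Lemma prime_actE h x n : prime_act h (odot N x n) =
  sw3 (fun h1 h2 h3 => odot N (h3 * x * O h1) (hact N h2 n)) h.
Proof. exact: prime_liftE. Qed.

Fact prime_act_bilin : bilin prime_act.
Proof.
split=> [t|h]; last exact: hom_linear.
move=> a u v; move: t.
apply: (prime_ext (f := prime_act (a *: u + v))
  (g := fun t => (a *: prime_act u + prime_act v) t)).
- by linearity.
- by linearity.
move=> x n; rewrite addhE scalehE !prime_actE.
suff: lin (fun h => sw3 (fun h1 h2 h3 => odot N (h3 * x * O h1) (hact N h2 n)) h) by apply.
by linearity.
Qed.

Fact prime_act1 t : prime_act 1 t = t.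
Proof.
move: t; apply: prime_ext => [||x n]; try by linearity.
rewrite prime_actE sw3_1; try by linearity.
by rewrite (anti1 O_anti) hact1 mul1r mulr1.
Qed.

Fact prime_actM g h t : prime_act (g * h) t = prime_act g (prime_act h t).
Proof.
move: t; apply: prime_ext => [||x n]; try by linearity.
rewrite !prime_actE sw3M; try by linearity.
rewrite (lin_sw3 (f := prime_act g)); last by linearity.
rewrite sw3C; apply: eq_sw3 => a b c; rewrite prime_actE; apply: eq_sw3 => a' b' c'.
by rewrite hactM (antiM O_anti) !mulrA.
Qed.

Definition prime_mod := HModule prime_act_bilin prime_act1 prime_actM.

Definition prime_coact_on x (n : N) : tens (prime_of N) H :=
  sw2 (fun x1 x2 => odot N x1 n \ot x2) x.

Fact prime_coact_on_linl n : lin (fun x => prime_coact_on x n).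
Proof. by rewrite /prime_coact_on; linearity. Qed.

Fact prime_coact_on_linr x : lin (fun n => prime_coact_on x n).
Proof. by rewrite /prime_coact_on; linearity. Qed.

(** Both sides are (x^2 ⊙ f(x^1)) ⊗ x^3. *)
Fact prime_coact_on_contra x (f : LHom H N) :
  prime_coact_on x (hcontra N f) = sw2 (fun x1 x2 => prime_coact_on x2 (f x1)) x.
Proof.
rewrite /prime_coact_on sw2A; try by linearity.
apply: eq_sw2 => x1 x2; rewrite odot_contra.
by rewrite (lin_sw2 (f := fun z => z \ot x2)); last by linearity.
Qed.

Definition prime_coact : LHom (prime_of N) (tens (prime_of N) H) :=
  prime_lift prime_coact_on_linl prime_coact_on_linr prime_coact_on_contra.

Lemma prime_coactE x n :
  prime_coact (odot N x n) = sw2 (fun x1 x2 => odot N x1 n \ot x2) x.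
Proof. exact: prime_liftE. Qed.

Fact prime_coactA t :
  tassoc _ _ _ (tmap prime_coact (idh _) (prime_coact t)) =
  tmap (idh _) (comul H) (prime_coact t).
Proof.
move: t; apply: prime_ext => [||x n]; try by linearity.
rewrite prime_coactE !tmapE tassocE !tlift_sw2; try by linearity.
transitivity (sw3 (fun a b c => odot N a n \ot (b \ot c)) x).
  by apply: eq_sw2 => x1 x2; rewrite prime_coactE tlift_sw2; linearity.
rewrite -sw2A; try by linearity.
apply: eq_sw2 => a b; rewrite -[in RHS](tlift_id (comul H b)).
by rewrite (lin_tlift (f := fun z => odot N a n \ot z)); last by linearity.
Qed.

Fact prime_coact_counit t : tlift (fun m0 m1 => ep m1 *: m0) (prime_coact t) = t.
Proof.
move: t; apply: prime_ext => [||x n]; try by linearity.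
rewrite prime_coactE tlift_sw2; try by linearity.
by rewrite (sw2_counitr (T := fun a => odot N a n)); last by linearity.
Qed.

Definition prime_comod := HComodule prime_coactA prime_coact_counit.

(** On x ⊙ n both sides are (h^4 x^1 O(h^2) ⊙ h^3 n) ⊗ h^5 x^2 O(h^1), again in two groupings
    related by [sw5]. *)
Fact prime_compat h t :
  hcoact prime_comod (hact prime_mod h t) =
  sw3 (fun h1 h2 h3 =>
    tlift (fun m0 m1 =>
      hact prime_mod h2 m0 \ot (h3 * m1 * Spow (-1 - 2 * (i - 1)) h1))
    (hcoact prime_comod t)) h.
Proof.
rewrite (_ : - 1 - 2 * (i - 1) = 1 - 2 * i); last by rewrite mulrBr opprB addrCA addrA.
move: t; apply: prime_ext => [||x n]; try by linearity.
rewrite [hact _ _ _]prime_actE (lin_sw3 (f := prime_coact)); last by linearity.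
under eq_sw3 => h1 h2 h3.
  rewrite prime_coactE sw2_xO; try by linearity.
  over.
rewrite (sw5 (F := fun p q b r s => sw2 (fun x1 x2 =>
  odot N (r * x1 * O q) (hact N b n) \ot (s * x2 * O p)) x)); try by linearity.
apply: eq_sw3 => h1 h2 h3; rewrite -sw2_sw3C [hcoact _ _]prime_coactE tlift_sw2; try by linearity.
apply: eq_sw2 => x1 x2; rewrite [hact prime_mod _ _]prime_actE.
by rewrite (lin_sw3 (f := fun z => z \ot (h3 * x2 * O h1))); last by linearity.
Qed.

Definition prime_YDmod : YDmod_on H (i - 1) (prime_of N) := YDModOn prime_compat.
End PrimeStructure.

Notation hatO := (fun M : YDmod H (i - 1) => YDCtr (hat_YDctr M)).
Notation primeO := (fun N : YDctr H (i + 1) => YDMod (prime_YDmod N)).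

(** * Functoriality of both constructions *)

Section HatMap.
Variables (M M' : YDmod H (i - 1)) (g : YDmod_hom M M').

Fact hat_map_colinear (f : hat M) : (g \oh f) \in is_colinear M'.
Proof.
apply/asboolP => x /=; rewrite ydm_map_coact hat_coact /= tlift_sw2 //; linearity.
Qed.

Definition hat_map_fun (f : hat M) : hat M' := HatOf (hat_map_colinear f).

Fact hat_map_linear : linear hat_map_fun.
Proof.
move=> a u v; apply: hat_ext => x.
transitivity (g (a *: (u : hat M) x + (v : hat M) x)); first by [].
by rewrite linearP.
Qed.

Definition hat_map_hom : LHom (hat M) (hat M') := mkLHom hat_map_linear.

Fact hat_map_act h f : hat_map_hom (hact (hatO M) h f) = hact (hatO M') h (hat_map_hom f).
Proof.
apply: hat_ext => x; rewrite [RHS]hat_actE /= (lin_sw3 (f := g)); last by linearity.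
by apply: eq_sw3 => a b c; rewrite ydm_map_act.
Qed.

Fact hat_map_contra (f : LHom H (hat M)) :
  hat_map_hom (hcontra (hatO M) f) = hcontra (hatO M') (hat_map_hom \oh f).
Proof.
by apply: hat_ext => x; rewrite [RHS]hat_contraE /= (lin_sw2 (f := g)); last by linearity.
Qed.

Definition hat_map : YDctr_hom (hatO M) (hatO M') :=
  @YDCtrHom k H (i + 1) (hatO M) (hatO M') hat_map_hom hat_map_act hat_map_contra.
End HatMap.

(** Kept transparent, like [prime_functor], so that the action on morphisms computes. *)
Definition hat_functor : @functor_on (YDmod_cat H (i - 1)) (YDctr_cat H (i + 1)) hatO.
Proof.
refine (@FunctorOn (YDmod_cat H (i - 1)) (YDctr_cat H (i + 1)) hatO hat_map _ _).
- by move=> M; apply: YDctr_hom_ext => f; apply: hat_ext.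
- by move=> M M' M'' g f; apply: YDctr_hom_ext => t; apply: hat_ext.
Defined.

Section PrimeMap.
Variables (N N' : YDctr H (i + 1)) (g : YDctr_hom N N').

Fact prime_map_linl n : lin (fun x => odot N' x (g n)).
Proof. by linearity. Qed.
Fact prime_map_linr x : lin (fun n => odot N' x (g n)).
Proof. by linearity. Qed.
Fact prime_map_rel x (f : LHom H N) :
  odot N' x (g (hcontra N f)) = sw2 (fun x1 x2 => odot N' x2 (g (f x1))) x.
Proof. by rewrite ydc_map_contra odot_contra. Qed.

Definition prime_map_hom : LHom (prime_of N) (prime_of N') :=
  prime_lift prime_map_linl prime_map_linr prime_map_rel.

Lemma prime_map_homE x n : prime_map_hom (odot N x n) = odot N' x (g n).
Proof. exact: prime_liftE. Qed.

Fact prime_map_act h t :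
  prime_map_hom (hact (primeO N) h t) = hact (primeO N') h (prime_map_hom t).
Proof.
move: t; apply: prime_ext => [||x n]; try by linearity.
rewrite prime_map_homE [hact _ _ _ in RHS]prime_actE [hact _ _ _ in LHS]prime_actE.
rewrite (lin_sw3 (f := prime_map_hom)); last by linearity.
by apply: eq_sw3 => a b c; rewrite prime_map_homE ydc_map_act.
Qed.

Fact prime_map_coact t :
  hcoact (primeO N') (prime_map_hom t) = tmap prime_map_hom (idh H) (hcoact (primeO N) t).
Proof.
move: t; apply: prime_ext => [||x n]; try by linearity.
rewrite prime_map_homE [LHS]prime_coactE [hcoact _ _]prime_coactE tmapE tlift_sw2; try by linearity.
by apply: eq_sw2 => a b; rewrite prime_map_homE.
Qed.

Definition prime_map : YDmod_hom (primeO N) (primeO N') :=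
  @YDModHom k H (i - 1) (primeO N) (primeO N') prime_map_hom prime_map_act prime_map_coact.
End PrimeMap.

Definition prime_functor : @functor_on (YDctr_cat H (i + 1)) (YDmod_cat H (i - 1)) primeO.
Proof.
refine (@FunctorOn (YDctr_cat H (i + 1)) (YDmod_cat H (i - 1)) primeO prime_map _ _).
- move=> N; apply: YDmod_hom_ext; apply: prime_ext => [||x n]; try by linearity.
  exact: prime_map_homE.
- move=> N N' N'' g f; apply: YDmod_hom_ext; apply: prime_ext => [||x n]; try by linearity.
  rewrite [LHS]prime_map_homE -[RHS]/(prime_map_hom g (prime_map_hom f (odot N x n))).
  by rewrite !prime_map_homE.
Defined.

(** * The adjunction bijection and its naturality *)

Section Adjunction.
Variables (N : YDctr H (i + 1)) (M : YDmod H (i - 1)).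

Section Right.
Variable g : YDmod_hom (primeO N) M.

Fact adj_linear n : linear (fun x => g (odot N x n)).
Proof. by suff: lin (fun x => g (odot N x n)) by []; linearity. Qed.

Fact adj_colinear n : mkLHom (adj_linear n) \in is_colinear M.
Proof.
apply/asboolP => x; rewrite [LHS](ydm_map_coact g) [hcoact _ _]prime_coactE.
by rewrite !tmapE tlift_sw2 //; linearity.
Qed.

Definition adj_fun n : hat M := HatOf (adj_colinear n).

Fact adj_fun_linear : linear adj_fun.
Proof.
move=> a u v; apply: hat_ext => x.
suff: lin (fun n : N => g (odot N x n)) by apply.
by linearity.
Qed.

Definition adj_hom : LHom N (hat M) := mkLHom adj_fun_linear.

(** Since [g] is a module map, the right side at x is g(h^4 S(h^5) x E(h^1) O(h^2) ⊙ h^3 n); the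
    outer pairs contract around h^3. *)
Fact adj_act h n : adj_hom (hact N h n) = hact (hatO M) h (adj_hom n).
Proof.
apply: hat_ext => x; rewrite [RHS]hat_actE /=.
transitivity (sw3 (fun h1 h2 h3 => sw3 (fun a b c =>
    g (odot N (c * S h3 * x * (E h1 * O a)) (hact N b n))) h2) h); last first.
  apply: eq_sw3 => h1 h2 h3; rewrite -[RHS](ydm_map_act g) [hact _ _ _]prime_actE.
  rewrite (lin_sw3 (f := g)); last by linearity.
  by apply: eq_sw3 => a b c; rewrite !mulrA.
symmetry; apply: (@sw_cancel _ _ _ (fun p q b r s =>
    g (odot N (r * S s * x * (E p * O q)) (hact N b n))) _ _ _ _ _
  (fun b => g (odot N x (hact N b n)))); try by linearity.
move=> u b v.
rewrite (@sw22_cancel _ (fun z w => g (odot N (z * x * w) (hact N b n))) _ _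
  (fun p q => E p * O q) (fun r s => r * S s)) ?sw2_EO ?sw2_antipoder //; try by linearity.
by rewrite mul1r mulr1.
Qed.

(** This is the defining relation of H ⊙_H N seen through [g]. *)
Fact adj_contra (f : LHom H N) :
  adj_hom (hcontra N f) = hcontra (hatO M) (adj_hom \oh f).
Proof.
apply: hat_ext => x; rewrite [RHS]hat_contraE /= odot_contra.
by rewrite (lin_sw2 (f := g)); last by linearity.
Qed.

Definition adj : YDctr_hom N (hatO M) :=
  @YDCtrHom k H (i + 1) N (hatO M) adj_hom adj_act adj_contra.
End Right.

Section Left.
Variable u : YDctr_hom N (hatO M).

Fact adjV_linl n : lin (fun x => (u n : hat M) x).
Proof. by linearity. Qed.
Fact adjV_linr x : lin (fun n => (u n : hat M) x).
Proof. by linearity. Qed.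
(** Conversely, compatibility of [u] with the contraactions is the relation that evaluation must
    respect. *)
Fact adjV_rel x (f : LHom H N) :
  (u (hcontra N f) : hat M) x = sw2 (fun x1 x2 => (u (f x1) : hat M) x2) x.
Proof. by rewrite ydc_map_contra [LHS]hat_contraE. Qed.

Definition adjV_hom : LHom (prime_of N) M := prime_lift adjV_linl adjV_linr adjV_rel.

Lemma adjV_homE x n : adjV_hom (odot N x n) = (u n : hat M) x.
Proof. exact: prime_liftE. Qed.

(** On x ⊙ n the left side is h^3 u(n)(S(h^4) h^5 x O(h^1) E(h^2)), and the outer pairs contract
    around h^3. *)
Fact adjV_act h t : adjV_hom (hact (primeO N) h t) = hact M h (adjV_hom t).
Proof.
move: t; apply: prime_ext => [||x n]; try by linearity.
rewrite adjV_homE [hact _ _ _ in LHS]prime_actE (lin_sw3 (f := adjV_hom)); last by linearity.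
transitivity (sw3 (fun h1 h2 h3 => sw3 (fun a b c =>
    hact M b ((u n : hat M) (S c * h3 * x * (O h1 * E a)))) h2) h).
  apply: eq_sw3 => h1 h2 h3; rewrite adjV_homE ydc_map_act [LHS]hat_actE.
  by apply: eq_sw3 => a b c; rewrite !mulrA.
apply: (@sw_cancel _ _ _ (fun p q b r s =>
    hact M b ((u n : hat M) (S r * s * x * (O p * E q)))) _ _ _ _ _
  (fun b => hact M b ((u n : hat M) x))); try by linearity.
move=> y b v.
rewrite (@sw22_cancel _ (fun z w => hact M b ((u n : hat M) (z * x * w))) _ _
  (fun p q => O p * E q) (fun r s => S r * s)) ?sw2_OE ?sw2_antipodel //; try by linearity.
by rewrite mul1r mulr1.
Qed.

Fact adjV_coact t : hcoact M (adjV_hom t) = tmap adjV_hom (idh H) (hcoact (primeO N) t).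
Proof.
move: t; apply: prime_ext => [||x n]; try by linearity.
rewrite adjV_homE hat_coact [hcoact _ _]prime_coactE tmapE tlift_sw2; try by linearity.
by apply: eq_sw2 => a b; rewrite adjV_homE.
Qed.

Definition adjV : YDmod_hom (primeO N) M :=
  @YDModHom k H (i - 1) (primeO N) M adjV_hom adjV_act adjV_coact.
End Left.

Lemma adjK : cancel adj adjV.
Proof.
move=> g; apply: YDmod_hom_ext; apply: prime_ext => [||x n]; try by linearity.
exact: adjV_homE.
Qed.

Lemma adjVK : cancel adjV adj.
Proof.
by move=> u; apply: YDctr_hom_ext => n; apply: hat_ext => x; apply: adjV_homE.
Qed.
End Adjunction.

(** Both naturality squares are checked by evaluating at n and then at x. *)
Lemma prime_hat_adjoint : left_adjoint prime_functor hat_functor.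
Proof.
exists adj; split=> [N M|N N' M u g|N M M' v g].
- by exists (@adjV N M); [apply: adjK|apply: adjVK].
- apply: YDctr_hom_ext => n; apply: hat_ext => x.
  by rewrite -[LHS]/(g (prime_map_hom u (odot N' x n))) prime_map_homE.
- by apply: YDctr_hom_ext => n; apply: hat_ext => x.
Qed.
End Twisted.

Theorem proposition5p5 (k : fieldType) (char_k : [pchar k] =i pred0)
    (H : invHopfAlgebra k) (i : int) :
  exists (hatS : forall M : YDmod H (i - 1), YDctr_on H (i + 1) (hat M))
         (primeS : forall N : YDctr H (i + 1), YDmod_on H (i - 1) (prime_of N)),
  [/\ forall (M : YDmod H (i - 1)) (h : H) (f : hat M) (x : H),
        hact (hatS M) h f x =
        sw3 (fun h1 h2 h3 =>
          hact M h2 (f (antipode H h3 * x * Spow (- (2 * i)) h1))) h,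
      forall (M : YDmod H (i - 1)) (theta : LHom H (hat M)) (h : H),
        hcontra (hatS M) theta h = sw2 (fun h1 h2 => theta h1 h2) h,
      forall (N : YDctr H (i + 1)) (h x : H) (n : N),
        hact (primeS N) h (odot N x n) =
        sw3 (fun h1 h2 h3 =>
          odot N (h3 * x * Spow (1 - 2 * i) h1) (hact N h2 n)) h,
      forall (N : YDctr H (i + 1)) (x : H) (n : N),
        hcoact (primeS N) (odot N x n) =
        sw2 (fun x1 x2 => odot N x1 n \ot x2) x
    & exists (hatF : @functor_on (YDmod_cat H (i - 1)) (YDctr_cat H (i + 1))
                       (fun M => YDCtr (hatS M)))
             (primeF : @functor_on (YDctr_cat H (i + 1)) (YDmod_cat H (i - 1))
                         (fun N => YDMod (primeS N))),
      [/\ forall (M M' : YDmod H (i - 1)) (g : YDmod_hom M M') (f : hat M) (x : H),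
            (fmor hatF g : YDctr_hom _ _) f x = g (f x),
          forall (N N' : YDctr H (i + 1)) (g : YDctr_hom N N') (x : H) (n : N),
            (fmor primeF g : YDmod_hom _ _) (odot N x n) = odot N' x (g n)
        & left_adjoint primeF hatF]].
Proof.
exists (@hat_YDctr k H i), (@prime_YDmod k H i).
split=> [M h f x|M theta h|N h x n|N x n|].
- exact: hat_actE.
- exact: hat_contraE.
- exact: prime_actE.
- exact: prime_coactE.
exists (@hat_functor k H i), (@prime_functor k H i); split=> [//|N N' g x n|].
- exact: prime_map_homE.
- exact: prime_hat_adjoint.
Qed.
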